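(* Let $\mathbf X$ be a finite dimensional Hilbert space. Assume that $f:\mathbf X\to[-\infty,\infty]$ is prox-regular and subdifferentially continuous at $\bar x$ for $\bar v\in\partial f(\bar x)$ and that $f$ is prox-bounded. Then the following properties are equivalent: (a) there exists a positive constant $r$ such that for any $\gamma\in(0,1/r)$, the proximal mapping $\mathrm{prox}_{\gamma f}$ is $\mathcal C^1$ around $\bar x+\gamma\bar v$; (b) there exists a positive constant $r$ such that for any $\gamma\in(0,1/r)$, the envelope function $e_\gamma f$ is $\mathcal C^2$ around $\bar x+\gamma\bar v$; (c) the subgradient mapping $\partial f$ is strictly proto-differentiable at $x$ for $v$ for all $(x,v)\in\mathrm{gph}\,\partial f$ close to $(\bar x,\bar v)$. If, in addition, $f$ is convex, then the constant $r$ in (a) and (b) can be taken as $0$ with the convention $1/0=\infty$.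
   Context: Set limits are in the Painlevé–Kuratowski sense. For a set $\Omega$ and $x\in\Omega$: $T_\Omega(x)=\limsup_{t\searrow0}\frac{\Omega-x}{t}$ (tangent cone), $\widehat T_\Omega(x)=\liminf_{x'\to x,\,x'\in\Omega,\,t\searrow0}\frac{\Omega-x'}{t}$ (regular tangent cone), $\widetilde T_\Omega(x)=\limsup_{x'\to x,\,x'\in\Omega,\,t\searrow0}\frac{\Omega-x'}{t}$ (paratingent cone). The regular normal cone is the polar $\widehat N_\Omega(x)=T_\Omega(x)^*$; the limiting normal cone $N_\Omega(\bar x)$ consists of limits of $v^k\in\widehat N_\Omega(x^k)$ with $x^k\to\bar x$, $x^k\in\Omega$. For $f$ with $f(\bar x)$ finite, $\partial f(\bar x)=\{v\mid(v,-1)\in N_{\mathrm{epi}f}(\bar x,f(\bar x))\}$. $f$ is prox-regular at $\bar x$ for $\bar v$ if $f$ is finite at $\bar x$, locally lower semicontinuous around $\bar x$, $\bar v\in\partial f(\bar x)$, and there exist $\varepsilon>0$, $r\ge0$ such that $f(x')\ge f(x)+\langle v,x'-x\rangle-\frac r2\|x'-x\|^2$ for all $x'$ with $\|x'-\bar x\|\le\varepsilon$ whenever $v\in\partial f(x)$, $\|(x,v)-(\bar x,\bar v)\|\le\varepsilon$ and $f(x)<f(\bar x)+\varepsilon$. $f$ is subdifferentially continuous at $\bar x$ for $\bar v$ if $(x^k,v^k)\to(\bar x,\bar v)$ with $v^k\in\partial f(x^k)$ implies $f(x^k)\to f(\bar x)$. $f$ is prox-bounded if $f+\alpha\|\cdot\|^2$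 is bounded from below on $\mathbf X$ for some $\alpha\in\mathbb R$. $\mathrm{prox}_{\gamma f}(x)=\mathrm{argmin}_{w\in\mathbf X}\{f(w)+\frac1{2\gamma}\|w-x\|^2\}$ and $e_\gamma f(x)=\inf_{w\in\mathbf X}\{f(w)+\frac1{2\gamma}\|w-x\|^2\}$. Saying that $\mathrm{prox}_{\gamma f}$ is $\mathcal C^1$ around a point means that it is single-valued and continuously differentiable on a neighborhood of that point. A set-valued mapping $F$ is strictly proto-differentiable at $x$ for $y\in F(x)$ if $\widehat T_{\mathrm{gph}F}(x,y)=\widetilde T_{\mathrm{gph}F}(x,y)$. *)

(* Defs.v *)
From HB Require Import structures.
From mathcomp Require Import all_boot all_order all_algebra.
From mathcomp Require Import all_classical all_reals all_analysis.

Set Implicit Arguments.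
Unset Strict Implicit.
Unset Printing Implicit Defensive.

Import Order.TTheory GRing.Theory Num.Theory.
Import numFieldNormedType.Exports.

Local Open Scope classical_set_scope.
Local Open Scope ring_scope.

(* A finite dimensional Hilbert space over R is a normed module X spanned by
   finitely many vectors, with an inner product ip : {dot X for idfun} (real
   symmetric positive definite bilinear form) inducing its norm. *)
Definition finite_dimensional (R : realType) (X : normedModType R) : Prop :=
  exists (n : nat) (b : 'I_n -> X),
    forall x, exists c : 'I_n -> R, x = \sum_(i < n) c i *: b i.

Definition induces_norm (R : realType) (X : normedModType R)
    (ip : X -> X -> R) : Prop :=
  forall x, `|x| ^+ 2 = ip x x.

Section cones.
Context {R : realType} {V : normedModType R}.
Implicit Types (A : set V) (x : V).

(* Sequential Painleve-Kuratowski limits of S along a filter F: the sequences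
   a of parameters "tend to F". *)
Definition outer_limit (T : Type) (F : set_system T) (S : T -> set V) : set V :=
  [set w | exists (a : nat -> T) (u : nat -> V),
    [/\ a @ \oo `=>` F, u @ \oo --> w & forall k, S (a k) (u k)]].

Definition inner_limit (T : Type) (F : set_system T) (S : T -> set V) : set V :=
  [set w | forall a : nat -> T, a @ \oo `=>` F ->
    exists u : nat -> V,
      u @ \oo --> w /\ \forall k \near \oo, S (a k) (u k)].

(* (A - x) / t *)
Definition difference_quotient A x (t : R) : set V :=
  [set t^-1 *: (y - x) | y in A].

Definition tangent_cone A x : set V :=
  outer_limit (0 : R)^'+ (difference_quotient A x).

Definition base_point_filter A x : set_system (V * R) :=
  filter_prod (within A (nbhs x)) (0 : R)^'+.

Definition regular_tangent_cone A x : set V :=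
  inner_limit (base_point_filter A x)
    (fun p => difference_quotient A p.1 p.2).

Definition paratingent_cone A x : set V :=
  outer_limit (base_point_filter A x)
    (fun p => difference_quotient A p.1 p.2).

Definition polar (ip : V -> V -> R) (K : set V) : set V :=
  [set v | forall w, K w -> ip v w <= 0].

Definition regular_normal_cone (ip : V -> V -> R) A x : set V :=
  polar ip (tangent_cone A x).

Definition limiting_normal_cone (ip : V -> V -> R) A x : set V :=
  [set v | exists (xk vk : nat -> V),
    [/\ xk @ \oo --> x, vk @ \oo --> v &
        forall k, A (xk k) /\ regular_normal_cone ip A (xk k) (vk k)]].

End cones.

Section smoothness.
Context {R : realType}.

(* The derivative is continuous at each point near z for the operator norm. *)
Definition C1_around (V W : normedModType R) (p : V -> W) (z : V) : Prop :=
  \forall y \near z, differentiable p y /\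
    forall e : R, 0 < e ->
      \forall y' \near y, forall h, `|'d p y' h - 'd p y h| <= e * `|h|.

Definition set_valued_C1_around (V W : normedModType R) (P : V -> set W)
    (z : V) : Prop :=
  exists p : V -> W,
    (\forall y \near z, P y = [set p y]) /\ C1_around p z.

(* G is the gradient of g with respect to ip. *)
Definition C2_around (V : normedModType R) (ip : V -> V -> R) (g : V -> R)
    (z : V) : Prop :=
  exists G : V -> V,
    (\forall y \near z, differentiable g y /\ forall h, 'd g y h = ip (G y) h)
    /\ C1_around G z.

Definition ereal_C2_around (V : normedModType R) (ip : V -> V -> R)
    (g : V -> \bar R) (z : V) : Prop :=
  (\forall y \near z, g y \is a fin_num) /\ C2_around ip (fine \o g) z.

End smoothness.

Section variational.
Context {R : realType} {X : normedModType R} (ip : X -> X -> R).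
Implicit Types (f : X -> \bar R) (x v xb vb : X).

Definition prod_ip (p q : X * R^o) : R := ip p.1 q.1 + p.2 * q.2.

Definition epigraph f : set (X * R^o) := [set p | (f p.1 <= p.2%:E)%E].

(* Empty where f is not finite. *)
Definition subdifferential f x : set X :=
  [set v | f x \is a fin_num /\
    limiting_normal_cone prod_ip (epigraph f) (x, fine (f x)) (v, -1)].

Definition graph (Y : Type) (F : X -> set Y) : set (X * Y) :=
  [set p | F p.1 p.2].

(* Local lower semicontinuity in the sense of Rockafellar and Wets: epi f is
   locally closed at (x, f x). It follows from lower semicontinuity of f at
   every point of some neighborhood of x. *)
Definition locally_lsc f x : Prop :=
  exists2 e : R, 0 < e &
    forall a : R, (a%:E <= f x + e%:E)%E ->
      closed [set y | `|y - x| <= e /\ (f y <= a%:E)%E].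

(* The library norm on X * X is the max norm, hence the explicit square root. *)
Definition prox_regular f xb vb : Prop :=
  [/\ f xb \is a fin_num, locally_lsc f xb, subdifferential f xb vb &
    exists (e r : R), [/\ 0 < e, 0 <= r &
      forall x v, subdifferential f x v ->
        Num.sqrt (`|x - xb| ^+ 2 + `|v - vb| ^+ 2) <= e ->
        (f x < f xb + e%:E)%E ->
        forall x', `|x' - xb| <= e ->
          (f x + (ip v (x' - x) - r / 2 * `|x' - x| ^+ 2)%:E <= f x')%E]].

Definition subdifferentially_continuous f xb vb : Prop :=
  forall xk vk : nat -> X,
    xk @ \oo --> xb -> vk @ \oo --> vb ->
    (forall k, subdifferential f (xk k) (vk k)) ->
    (f \o xk) @ \oo --> f xb.

Definition prox_bounded f : Prop :=
  exists a m : R, forall x, (m%:E <= f x + (a * `|x| ^+ 2)%:E)%E.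

Definition convex_ereal f : Prop := convex_set (epigraph f).

Definition argmin (g : X -> \bar R) : set X :=
  [set w | forall w', (g w <= g w')%E].

Definition prox_objective (gamma : R) f x (w : X) : \bar R :=
  (f w + ((2 * gamma)^-1 * `|w - x| ^+ 2)%:E)%E.

Definition prox (gamma : R) f x : set X := argmin (prox_objective gamma f x).

Definition envelope (gamma : R) f x : \bar R :=
  ereal_inf (range (prox_objective gamma f x)).

Definition strictly_proto_differentiable (Y : normedModType R)
    (F : X -> set Y) x (y : Y) : Prop :=
  regular_tangent_cone (graph F) (x, y) = paratingent_cone (graph F) (x, y).

(* The bound 1/r is taken in \bar R, where 0^-1 = +oo. *)
Definition prox_C1_below f xb vb (r : R) : Prop :=
  forall gamma : R, 0 < gamma -> (gamma%:E < (r%:E)^-1)%E ->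
    set_valued_C1_around (prox gamma f) (xb + gamma *: vb).

Definition envelope_C2_below f xb vb (r : R) : Prop :=
  forall gamma : R, 0 < gamma -> (gamma%:E < (r%:E)^-1)%E ->
    ereal_C2_around ip (envelope gamma f) (xb + gamma *: vb).

Definition strictly_proto_differentiable_around f xb vb : Prop :=
  \forall p \near (xb, vb), graph (subdifferential f) p ->
    strictly_proto_differentiable (subdifferential f) p.1 p.2.

End variational.

(* Main.v *)
Require Import Defs.
From HB Require Import structures.
From mathcomp Require Import all_boot all_order all_algebra.
From mathcomp Require Import all_classical all_reals all_analysis.
From mathcomp Require Import ring lra.

(** Prox-regularity, together with subdifferential continuity and
prox-boundedness, yields constants [r] and [d] such that every subgradient [v]
of [f] at [x], with [(x, v)] within [d] of [(xb, vb)], provides a minorant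
[f x + ip v (y - x) - r / 2 * `|y - x| ^+ 2] valid for all [y]
([prox_regular_global]); when [f] is convex one may take [r = 0]
([convex_subgradient]). Fix [gamma] with [0 < gamma] and [gamma * r < 1] and put
[zb = xb + gamma *: vb]. Both parts of the theorem follow from the equivalence of
the three properties for this single [gamma] ([prox_envelope_proto_equiv]): the
last property does not mention [gamma], so it carries smoothness from one
parameter to all admissible ones.

Since [gamma^-1 > r], the objective defining the proximal mapping grows
quadratically around its minimizer. Hence for [z] near [zb] a minimizer exists
([exists_prox]), it is unique, it depends on [z] in a Lipschitz way, and the
pairs [(P z, gamma^-1 *: (z - P z))], where [P z] denotes the minimizer, fill out
the graph of the subdifferential near [(xb, vb)]: the shear
[(x, v) |-> x + gamma *: v] turns that graph into the graph of the Lipschitz map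
[P] ([selection_local_resolvent]). All three properties are then statements
about [P], each equivalent to its strict differentiability at every point
near [zb].

- For maps, being C1 around a point is the same as being strictly differentiable
  at all nearby points ([C1_aroundP]); this settles the proximal mapping.
- The envelope has the gradient [gamma^-1 *: (z - P z)], because the minimizer at
  one parameter is a competitor at the other ([envelope_upper]); so it is C2 iff
  [P] is C1.
- In sheared coordinates the paratingent cone consists of all limits of
  difference quotients of [P]. If [P] is strictly differentiable this cone is the
  graph of the derivative, and every element of it is also a regular tangent.
  Conversely the regular tangent cone is convex and the paratingent cone is
  symmetric, so when they coincide they form a linear subspace. As [P] is
  Lipschitz, this subspace is the graph of a linear map, and compactness turns
  this map into a strict derivative
  ([strict_proto_strictly_differentiable]). *)

Set Implicit Arguments.
Unset Strict Implicit.
Unset Printing Implicit Defensive.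

Import Order.TTheory GRing.Theory Num.Theory.
Import numFieldNormedType.Exports.

Local Open Scope classical_set_scope.
Local Open Scope ring_scope.

(** * Inner products and compactness in finite dimension *)

Section inner_product.
Context {R : realType} {X : normedModType R} (ip : {dot X for idfun}).
Hypothesis hip : induces_norm ip.

Lemma ipC x y : ip x y = ip y x.
Proof. by rewrite hermC /= expr0 mul1r. Qed.

Lemma ipDl x y z : ip (x + y) z = ip x z + ip y z.
Proof. exact: linearDl. Qed.

Lemma ipBl x y z : ip (x - y) z = ip x z - ip y z.
Proof. exact: linearBl. Qed.

Lemma ipZl a x y : ip (a *: x) y = a * ip x y.
Proof. exact: linearZl_LR. Qed.

Lemma ipNl x y : ip (- x) y = - ip x y.
Proof. exact: linearNl. Qed.

Lemma ipDr x y z : ip x (y + z) = ip x y + ip x z.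
Proof. by rewrite ipC ipDl !(ipC x). Qed.

Lemma ipBr x y z : ip x (y - z) = ip x y - ip x z.
Proof. by rewrite ipC ipBl !(ipC x). Qed.

Lemma ipZr a x y : ip x (a *: y) = a * ip x y.
Proof. by rewrite ipC ipZl ipC. Qed.

Lemma ip0l x : ip 0 x = 0.
Proof. exact: linear0l. Qed.

Lemma normD_sqr x y : `|x + y| ^+ 2 = `|x| ^+ 2 + 2 * ip x y + `|y| ^+ 2.
Proof. by rewrite !hip ipDl !ipDr (ipC y x); ring. Qed.

Lemma normB_sqr x y : `|x - y| ^+ 2 = `|x| ^+ 2 - 2 * ip x y + `|y| ^+ 2.
Proof. by rewrite !hip ipBl !ipBr (ipC y x); ring. Qed.

Lemma ip_le x y : ip x y <= `|x| * `|y|.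
Proof.
have [->|x0] := eqVneq x 0; first by rewrite ip0l normr0 mul0r.
have [->|y0] := eqVneq y 0; first by rewrite ipC ip0l normr0 mulr0.
have xp : 0 < `|x| by rewrite normr_gt0.
have yp : 0 < `|y| by rewrite normr_gt0.
have : 0 <= `| (`|y| *: x) - (`|x| *: y) | ^+ 2 by rewrite exprn_ge0.
rewrite normB_sqr ipZl ipZr !normrZ !normr_id => h.
rewrite -(ler_pM2l (mulr_gt0 xp yp)); nra.
Qed.

Lemma ip_norm_le x y : `|ip x y| <= `|x| * `|y|.
Proof.
rewrite ler_norml ip_le andbT.
by have := ip_le (- x) y; rewrite ipNl normrN; lra.
Qed.

(** The orthogonal projection onto the span of [s], correct as soon as the
entries of [s] are pairwise orthogonal; zero entries are harmless because
[0^-1 = 0]. *)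
Definition ortho_proj (s : seq X) x := \sum_(e <- s) (ip x e / ip e e) *: e.

Lemma ip_sum_eq0 (s : seq X) (c : X -> R) y :
  (forall e, e \in s -> ip y e = 0) -> ip y (\sum_(e <- s) c e *: e) = 0.
Proof.
elim: s => [|e s ih] h; first by rewrite big_nil ipC ip0l.
rewrite big_cons ipDr ipZr h ?mem_head// mulr0 add0r; apply: ih => e' es.
by apply: h; rewrite inE es orbT.
Qed.

(** Gram-Schmidt. The invariant carried along the induction is that the
residual of the projection is orthogonal to every vector of the family, which
spares a separate treatment of pairwise orthogonality. *)
Lemma gram_schmidt n (b : 'I_n -> X) : exists s : seq X,
  [/\ forall x e, e \in s -> ip (x - ortho_proj s x) e = 0 &
      forall i, ortho_proj s (b i) = b i].
Proof.
elim: n b => [|n ih] b.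
  by exists [::]; split => // -[].
have [s [orth fix_]] := ih (fun i => b (lift ord0 i)).
pose c := b ord0 - ortho_proj s (b ord0).
have projE x : ortho_proj (c :: s) x = (ip x c / ip c c) *: c + ortho_proj s x.
  by rewrite /ortho_proj big_cons.
have c_orth e : e \in s -> ip c e = 0 by exact: orth.
have cK x : ip x c / ip c c * ip c c = ip x c.
  have [->|c0] := eqVneq c 0; first by rewrite (ipC x) !ip0l mulr0.
  by rewrite divfK// -hip sqrf_eq0 normr_eq0.
have residual x : ip (x - ortho_proj (c :: s) x) c = 0.
  rewrite projE ipBl ipDl ipZl cK.
  by rewrite (ipC (ortho_proj s x)) (ip_sum_eq0 _ c_orth) addr0 subrr.
exists (c :: s); split=> [x e|i].
  rewrite inE => /orP[/eqP ->|es]; first exact: residual.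
  rewrite projE opprD addrCA ipDl ipNl ipZl (c_orth _ es) mulr0 oppr0 add0r.
  exact: orth.
have [->|[j ->]] : i = ord0 \/ exists j, i = lift ord0 j.
  by case: (unliftP ord0 i) => [j|] ->; [right; exists j|left].
- set t := ip (b ord0) c / ip c c.
  have E : b ord0 - ortho_proj (c :: s) (b ord0) = (1 - t) *: c.
    by rewrite projE /c scalerBl scale1r opprD addrCA addrC.
  apply/eqP; rewrite eq_sym -subr_eq0 E -normr_eq0 -sqrf_eq0 hip ipZr -E.
  by rewrite residual mulr0.
- rewrite projE fix_ -[in X in ip X c](fix_ j) ipC.
  by rewrite (ip_sum_eq0 _ c_orth) mul0r scale0r add0r.
Qed.

Hypothesis hdim : finite_dimensional X.

Lemma orthogonal_expansion : exists s : seq X, forall x, x = ortho_proj s x.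
Proof.
have [n [b hb]] := hdim; have [s [_ hs]] := gram_schmidt b.
exists s => x; have [c ->] := hb x.
rewrite {1}(eq_bigr (fun i => c i *: ortho_proj s (b i))); last first.
  by move=> i _; rewrite hs.
rewrite {1}/ortho_proj; under eq_bigr do rewrite scaler_sumr.
rewrite exchange_big /=; apply: eq_bigr => e _.
under eq_bigr do rewrite scalerA mulrA; rewrite -scaler_suml -mulr_suml.
congr (_ / _ *: _); elim/big_ind2: _ => [|u a v a' -> ->|i _].
- by rewrite ip0l.
- by rewrite ipDl.
- by rewrite ipZl.
Qed.

End inner_product.

Section bolzano_weierstrass.
Context {R : realType}.

Lemma cvg_subseq (T : topologicalType) (u : nat -> T) (l : T)
    (phi : nat -> nat) :
  (forall n, (n <= phi n)%N) -> u @ \oo --> l -> (u \o phi) @ \oo --> l.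
Proof.
move=> hphi hu A /hu [N _ hN]; exists N => // n /= Nn.
exact/hN/(leq_trans Nn).
Qed.

(** The extraction is only required to satisfy [n <= phi n]: this suffices to
preserve limits, and it composes without monotonicity arguments. *)
Lemma bounded_real_subseq (u : nat -> R) (M : R) :
  (forall n, `|u n| <= M) ->
  exists (phi : nat -> nat) (l : R),
    (forall n, (n <= phi n)%N) /\ (u \o phi) @ \oo --> l.
Proof.
move=> hM.
have [] := @segment_compact R (- M) M (u @ \oo).
  by exists 0%N => // n _ /=; rewrite in_itv /= -ler_norml.
move=> l [_ hl].
have pick n : exists k, (n <= k)%N /\ `|l - u k| < n.+1%:R^-1.
  have n0 : 0 < n.+1%:R^-1 :> R by rewrite invr_gt0 ltr0Sn.
  have [|_ [[k nk <-] hk]] := hl [set u k | k in [set k | (n <= k)%N]] _ _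
      (nbhsx_ballx (l : R) _ n0); last by exists k.
  by exists n => // k /= nk; exists k.
have [phi hphi] := choice pick.
exists phi, l; split=> [n|]; first by have [] := hphi n.
apply/cvgrPdist_lt => e e0; near=> n.
have [_ /lt_trans] := hphi n; apply; near: n.
exact: near_infty_natSinv_lt (PosNum e0).
Unshelve. all: by end_near. Qed.

Context {X : normedModType R} (ip : {dot X for idfun}).
Hypotheses (hip : induces_norm ip) (hdim : finite_dimensional X).

(** Coordinates are treated one at a time along an orthogonal expansion, each
step extracting from the previous subsequence. *)
Lemma bounded_subseq (u : nat -> X) (M : R) :
  (forall n, `|u n| <= M) ->
  exists (phi : nat -> nat) (l : X),
    (forall n, (n <= phi n)%N) /\ (u \o phi) @ \oo --> l.
Proof.
move=> hM; have [s hs] := orthogonal_expansion hip hdim.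
have [phi [l [hphi hl]]] : exists (phi : nat -> nat) (l : X),
    (forall n, (n <= phi n)%N) /\
    (fun n => ortho_proj ip s (u (phi n))) @ \oo --> l.
  elim: s {hs} => [|e s [phi [l [hphi hl]]]].
    exists id, 0; split=> //; rewrite /ortho_proj.
    under eq_fun do rewrite big_nil; exact: cvg_cst.
  have [n|psi [c [hpsi hc]]] :=
      @bounded_real_subseq (fun n => ip (u (phi n)) e / ip e e)
                           (M * `|e| / `|ip e e|).
    rewrite normrM normfV ler_wpM2r ?invr_ge0//.
    by rewrite (le_trans (ip_norm_le hip _ _))// ler_wpM2r.
  exists (phi \o psi), (c *: e + l); split.
    by move=> n /=; rewrite (leq_trans (hpsi n)).
  rewrite /ortho_proj; under eq_fun do rewrite big_cons.
  apply: cvgD; last exact: cvg_subseq hpsi hl.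
  by apply: cvgZr_tmp; exact: hc.
exists phi, l; split=> //.
rewrite (_ : u \o phi = fun n => ortho_proj ip s (u (phi n)))//.
by apply/funext => n /=; rewrite -hs.
Qed.

End bolzano_weierstrass.

Section sequences.
Context {R : realType}.

Lemma cvg_step (V : normedModType R) (q u : nat -> V) (t : nat -> R) (p w : V) :
  q @ \oo --> p -> t @ \oo --> 0 -> u @ \oo --> w ->
  (fun k => q k + t k *: u k) @ \oo --> p.
Proof.
move=> qp t0 uw; rewrite -[X in _ --> X](addr0 p) -(scale0r w).
by apply: cvgD => //; exact: cvgZ.
Qed.

Lemma cvg_harmonic_dist (V : normedModType R) (c : nat -> V) (z : V) :
  (forall k, `|c k - z| < harmonic k) -> c @ \oo --> z.
Proof.
move=> hc; apply/cvgrPdist_lt => e e0.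
have /cvgrPdist_lt/(_ e e0) := @cvg_harmonic R; apply: filterS => k.
rewrite sub0r normrN distrC => hk.
by rewrite (lt_trans (hc k))// (le_lt_trans (ler_norm _)).
Qed.

Lemma linear_bounded_cvg (V W : normedModType R) (D : V -> W) (M : R)
    (u : nat -> V) (l : V) :
  linear D -> (forall h, `|D h| <= M * `|h|) -> u @ \oo --> l ->
  (fun k => D (u k)) @ \oo --> D l.
Proof.
move=> Dlin DM ul.
pose DL : {linear V -> W} := HB.pack D (GRing.isLinear.Build _ _ _ _ _ Dlin).
apply/cvgrPdist_le => e e0.
have M1 : 0 < `|M| + 1 by rewrite ltr_wpDl.
have /cvgrPdist_le/(_ _ (divr_gt0 e0 M1)) := ul; apply: filterS => k /=.
rewrite ler_pdivlMr// => hk; rewrite -[D]/(DL : _ -> _) -linearB.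
rewrite (le_trans (DM _))// (le_trans _ hk)// mulrC ler_wpM2l//.
by have := ler_norm M; lra.
Qed.

End sequences.

(** * Strict differentiability and continuous differentiability *)

Section strict_differentiability.
Context {R : realType}.

Lemma near_norm (V : normedModType R) (z : V) (Q : V -> Prop) :
  (\forall y \near z, Q y) <->
  exists2 d : R, 0 < d & forall y, `|y - z| < d -> Q y.
Proof.
rewrite nbhs_normP; split=> -[d d0 hd]; exists d => // y /= yz; apply: hd.
  by rewrite /= distrC.
by rewrite distrC.
Qed.

Lemma linear_scale (V W : normedModType R) (E : V -> W) (t : R) h :
  linear E -> E (t *: h) = t *: E h.
Proof.
move=> El.
pose EL : {linear V -> W} := HB.pack E (GRing.isLinear.Build _ _ _ _ _ El).
exact: (linearZ_LR EL).
Qed.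

(** The bound on [D] is the continuity of the linear map [D]. *)
Definition strict_derivative (V W : normedModType R) (p : V -> W) (z : V)
    (D : V -> W) : Prop :=
  [/\ linear D, exists M : R, forall h, `|D h| <= M * `|h| &
      forall e : R, 0 < e -> exists2 d : R, 0 < d &
        forall a b, `|a - z| < d -> `|b - z| < d ->
          `|p a - p b - D (a - b)| <= e * `|a - b|].

Definition strictly_differentiable (V W : normedModType R) (p : V -> W)
    (z : V) : Prop := exists D, strict_derivative p z D.

Lemma is_diff_estimate (V W : normedModType R) (p : V -> W) (x : V)
    (D : {linear V -> W}) (M : R) :
  (forall h, `|D h| <= M * `|h|) ->
  (forall e : R, 0 < e -> exists2 d : R, 0 < d &
     forall y, `|y - x| < d -> `|p y - p x - D (y - x)| <= e * `|y - x|) ->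
  differentiable p x /\ 'd p x = D :> (V -> W).
Proof.
move=> hM est.
have Dc : continuous D.
  apply/linear_bounded_continuous; exists (Num.max M 0); split.
    by rewrite ger0_real// le_max lexx orbT.
  move=> N MN; near=> h; apply: (le_trans (hM h)).
  have h1 : `|h| <= 1.
    near: h; apply/nbhs_normP; exists 1 => //= h.
    by rewrite /= sub0r normrN => /ltW.
  have {}MN := ltW MN; have M0 : 0 <= Num.max M 0 by rewrite le_max lexx orbT.
  rewrite (le_trans _ MN)// (@le_trans _ _ (Num.max M 0 * `|h|))//.
    by rewrite ler_wpM2r// le_max lexx.
  by rewrite ler_piMr.
have E : p \o shift x = cst (p x) + D +o_ 0 id.
  apply/eqaddoP => e e0; have [d d0 hd] := est e e0.
  apply/nbhs_normP; exists d => //= h; rewrite /= sub0r normrN => hh.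
  have := hd (h + x); rewrite addrK => /(_ hh).
  by rewrite !fctE /= opprD addrA.
have dE : 'd p x = D :> (V -> W) by exact: diff_unique.
split=> //; apply/diff_locallyP; split; first by rewrite dE.
by rewrite E dE.
Unshelve. all: by end_near. Qed.

Lemma linear_bounded (V W : normedModType R) (D : {linear V -> W}) :
  continuous D -> exists M : R, forall h, `|D h| <= M * `|h|.
Proof. by move=> /linear_lipschitz [k _ hk]; exists k. Qed.

Lemma strict_derivative_diff (V W : normedModType R) (p : V -> W) z D :
  strict_derivative p z D -> differentiable p z /\ 'd p z = D :> (V -> W).
Proof.
move=> [Dlin [M hM] est].
pose DL : {linear V -> W} := HB.pack D (GRing.isLinear.Build _ _ _ _ _ Dlin).
apply: (@is_diff_estimate _ _ _ _ DL M) => // e e0.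
have [d d0 hd] := est e e0; exists d => // y yz.
by apply: hd => //; rewrite subrr normr0.
Qed.

(** At [y'] near [y], a small step along [h] starting from [y'] is controlled by
the strict derivatives at both points; comparing them bounds the difference of
the two derivatives. *)
Lemma near_strictly_differentiable_C1 (V W : normedModType R) (p : V -> W) z :
  (\forall y \near z, strictly_differentiable p y) -> C1_around p z.
Proof.
move=> /nbhs_interior; apply: filterS => y /near_norm [d0 d0p near_y].
have [|D Dy] := near_y y; first by rewrite subrr normr0.
have [dpy ->] := strict_derivative_diff Dy.
split=> // e e0.
have [Dlin [M hM] est] := Dy; have e20 : 0 < e / 2 by rewrite divr_gt0.
have [d d_gt0 hd] := est _ e20.
apply/near_norm; exists (Num.min d0 d); first by rewrite lt_min d0p.
move=> y'; rewrite lt_min => /andP[/near_y [D' Dy'] y'd] h.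
have [_ ->] := strict_derivative_diff Dy'.
have [D'lin _ est'] := Dy'; have [d' d'0 hd'] := est' _ e20.
have h1 : 0 < `|h| + 1 by rewrite ltr_wpDl.
(* a step along [h] short enough for both estimates *)
pose t := Num.min d' (d - `|y' - y|) / 2 / (`|h| + 1).
have t0 : 0 < t by rewrite !divr_gt0// lt_min d'0 subr_gt0.
have th : `|t *: h| < Num.min d' (d - `|y' - y|).
  rewrite normrZ gtr0_norm// /t; set m := Num.min _ _.
  have m0 : 0 < m by rewrite lt_min d'0 subr_gt0.
  by rewrite mulrAC ltr_pdivrMr//; have := normr_ge0 h; nra.
move: th; rewrite lt_min => /andP[th' th].
have := hd (y' + t *: h) y' _ y'd; have := hd' (y' + t *: h) y'.
rewrite [_ + _ - y']addrAC subrr add0r normr0 => /(_ th' d'0) A /(_ _) B.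
have {}B := B _; have {B} := B (_ : `|y' + t *: h - y| < d).
rewrite addrAC; move=> /(_ (le_lt_trans (ler_normD _ _) _)).
rewrite -ltrBrDl => /(_ th) B.
move: A B; rewrite (linear_scale t h Dlin) (linear_scale t h D'lin) => A B.
have : `|t *: (D' h - D h)| <= t * (e * `|h|).
  rewrite scalerBr; set q := p (y' + t *: h) - p y' in A B.
  have -> : t *: D' h - t *: D h = (q - t *: D h) - (q - t *: D' h).
    by rewrite opprB [RHS]addrC subrKA.
  rewrite (le_trans (ler_normB _ _))//.
  have := lerD B A; rewrite normrZ gtr0_norm//; lra.
by rewrite normrZ gtr0_norm// ler_pM2l.
Qed.

Lemma strictly_differentiable_affine (V : normedModType R) (p : V -> V) z
    (a k : R) : strictly_differentiable p z ->
  strictly_differentiable (fun y => a *: y + k *: p y) z.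
Proof.
move=> [D [Dlin [M hM] est]]; exists (fun h => a *: h + k *: D h); split.
- move=> c u v; rewrite Dlin !scalerDr !scalerA ![_ * c]mulrC.
  by rewrite addrACA.
- exists (`|a| + `|k| * M) => h.
  rewrite (le_trans (ler_normD _ _))// !normrZ mulrDl lerD2l -mulrA.
  by rewrite ler_wpM2l.
- move=> e e0; have k1 : 0 < `|k| + 1 by rewrite ltr_wpDl.
  have [d d0 hd] := est (e / (`|k| + 1)) (divr_gt0 e0 k1).
  exists d => // x y xz yz; have {}hd := hd x y xz yz.
  have -> : a *: x + k *: p x - (a *: y + k *: p y) -
      (a *: (x - y) + k *: D (x - y)) = k *: (p x - p y - D (x - y)).
    rewrite opprD addrACA -!scalerBr opprD addrACA subrr add0r.
    by rewrite -scalerBr.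
  rewrite normrZ (le_trans (ler_wpM2l _ hd))// mulrA ler_wpM2r//.
  by rewrite mulrCA ger_pMr// ler_pdivrMr// mul1r; lra.
Qed.

Lemma strictly_differentiable_near (V W : normedModType R) (p q : V -> W) z :
  (\forall y \near z, p y = q y) -> strictly_differentiable p z ->
  strictly_differentiable q z.
Proof.
move=> /near_norm [d0 d0p pq] [D [Dlin hM est]]; exists D; split=> // e e0.
have [d d_gt0 hd] := est e e0; exists (Num.min d0 d).
  by rewrite lt_min d0p.
move=> a b; rewrite !lt_min => /andP[a0 ad] /andP[b0 bd].
by rewrite -!pq//; exact: hd.
Qed.

Lemma near_strictly_differentiable_eq (V W : normedModType R) (p q : V -> W)
    (z : V) :
  (\forall y \near z, p y = q y) ->
  (\forall y \near z, strictly_differentiable p y) ->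
  \forall y \near z, strictly_differentiable q y.
Proof.
move=> /nbhs_interior; apply: filterS2 => y.
exact: strictly_differentiable_near.
Qed.

End strict_differentiability.

Section C1_strict.
Context {R : realType} {X : normedModType R} (ip : {dot X for idfun}).
Hypothesis hip : induces_norm ip.

Lemma ip_continuous u : continuous (ip u : X -> R).
Proof.
apply/linear_bounded_continuous; exists `|u|; split; first exact: num_real.
move=> N uN; apply/near_norm; exists 1 => // h; rewrite subr0 => /ltW h1.
apply: (le_trans (ip_norm_le hip _ _)).
by rewrite (le_trans _ (ltW uN))// ler_piMr.
Qed.

(** The vector-valued mean value inequality follows from the real mean value
theorem applied to the component of the increment along the increment itself. *)
Lemma mean_value_le (p : X -> X) (D : {linear X -> X}) (a b : X) (e : R) :
  (forall t : R, 0 <= t <= 1 -> differentiable p (b + t *: (a - b)) /\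
     `|'d p (b + t *: (a - b)) (a - b) - D (a - b)| <= e * `|a - b|) ->
  `|p a - p b - D (a - b)| <= e * `|a - b|.
Proof.
move=> hp; set h := a - b; set u := p a - p b - D h.
pose q (t : R) := p (b + t *: h).
pose g (t : R) : R := ip u (q t) - t * ip u (D h).
pose dg t := ip u ('d p (b + t *: h) h - D h).
have g_diff (t : R) : 0 <= t <= 1 -> is_derive t 1 g (dg t).
  move=> /hp[dp _].
  pose l : R -> X := cst b + (fun s => s *: h).
  have dl : is_diff t l (0 + (fun s : R => s *: h)) by exact: is_diffD.
  have dp' : is_diff (l t) p ('d p (l t)) by exact: differentiableP.
  have du : is_diff (p (l t)) (ip u) (ip u).
    apply: DiffDef; first exact/linear_differentiable/ip_continuous.
    exact/diff_lin/ip_continuous.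
  have dg' : is_diff t (ip u \o (p \o l) - (fun s : R => s *: ip u (D h)))
      (ip u \o ('d p (l t) \o (0 + (fun s : R => s *: h))) -
       (fun s : R => s *: ip u (D h))) by exact: is_diffB.
  have -> : g = ip u \o (p \o l) - (fun s : R => s *: ip u (D h)) by [].
  split; first exact: diff_derivable.
  by rewrite deriveE// diff_val !fctE /= !scale1r add0r /dg ipBr.
have [||c] := @MVT R g dg 0 1 ltr01.
- by move=> t /=; rewrite in_itv /= => /andP[t0 t1]; apply: g_diff; rewrite !ltW.
- apply: derivable_within_continuous => t; rewrite in_itv /= => /g_diff gt.
  exact: ex_derive.
move=> c01; rewrite subr0 mulr1 /g /q scale1r scale0r addr0 mul0r subr0 mul1r.
rewrite [b + h]addrC subrK => E.
have {E} : `|u| ^+ 2 = dg c.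
  by rewrite -E hip {2}/u !ipBr; ring.
have he : 0 <= e * `|h|.
  have [|_ ] := hp 0; first by rewrite lexx ler01.
  exact: le_trans.
have [-> _|u0 E] := eqVneq u 0; first by rewrite normr0.
have /hp[_ cb] : 0 <= c <= 1.
  by move: c01; rewrite in_itv /= => /andP[/ltW -> /ltW ->].
have : `|u| ^+ 2 <= `|u| * (e * `|h|).
  by rewrite E /dg (le_trans (ip_le hip _ _))// ler_wpM2l.
by rewrite expr2 ler_pM2l// normr_gt0.
Qed.

(** Balls are convex, so the segment between two points near [y] stays in the
region where the derivative is close to its value at [y], and the mean value
inequality applies along it. *)
Lemma C1_near_strictly_differentiable (p : X -> X) z :
  C1_around p z -> \forall y \near z, strictly_differentiable p y.
Proof.
move=> /nbhs_interior; apply: filterS => y /near_norm[d0 d0p near_y].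
have [|dpy cont] := near_y y; first by rewrite subrr normr0.
exists ('d p y); split; first exact: linearP.
  by apply: linear_bounded; exact: diff_continuous.
move=> e e0; have /near_norm[d d_gt0 hd] := cont e e0.
exists (Num.min d0 d); first by rewrite lt_min d0p.
move=> a b ay bY; apply: mean_value_le => t /andP[t0 t1].
have : `|b + t *: (a - b) - y| < Num.min d0 d.
  have -> : b + t *: (a - b) - y = t *: (a - y) + (1 - t) *: (b - y).
    rewrite scalerBl scale1r addrCA -scalerBr opprB addrA subrK.
    by rewrite addrAC.
  apply: (le_lt_trans (ler_normD _ _)); rewrite !normrZ !ger0_norm ?subr_ge0//.
  set m := Num.min _ _ in ay bY *.
  have [->|tn0] := eqVneq t 0; first by rewrite mul0r add0r subr0 mul1r.
  have tp : 0 < t by rewrite lt_neqAle eq_sym tn0.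
  have : t * `|a - y| < t * m by rewrite ltr_pM2l.
  have : (1 - t) * `|b - y| <= (1 - t) * m.
    by rewrite ler_wpM2l ?subr_ge0// ltW.
  lra.
by rewrite lt_min => /andP[/near_y[dp _] /hd].
Qed.

Lemma C1_aroundP (p : X -> X) z :
  C1_around p z <-> \forall y \near z, strictly_differentiable p y.
Proof.
split; [exact: C1_near_strictly_differentiable|].
exact: near_strictly_differentiable_C1.
Qed.

End C1_strict.

(** * Tangent cones through sequences *)

Section cone_sequences.
Context {R : realType} {V : normedModType R}.
Implicit Types (A : set V) (p w : V).

Lemma cvg_base_point A p (q : nat -> V) (t : nat -> R) :
  (fun k => (q k, t k)) @ \oo `=>` base_point_filter A p <->
  [/\ q @ \oo --> p, t @ \oo --> 0 &
      \forall k \near \oo, A (q k) /\ 0 < t k].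
Proof.
split=> [h|[qp t0 At]].
- have h1 : q @ \oo `=>` within A (nbhs p).
    move=> B hB; apply: (h [set x | B x.1]); exists (B, setT) => [|x []//].
    by split=> //; exact: filterT.
  have h2 : t @ \oo `=>` (0 : R)^'+.
    move=> B hB; apply: (h [set x | B x.2]); exists (setT, B) => [|x []//].
    by split=> //; exact: filterT.
  split; [exact: cvg_trans h1 (cvg_within _)|exact: cvg_trans h2 (cvg_within _)|].
  apply: filterI; first by apply: (h1 A); exact: withinT.
  by apply: (h2 [set s | 0 < s]); exact: nbhs_right_gt.
- move=> S [[B T] /= [/qp hB /t0 hT] BT]; near=> k; apply: BT.
  have [Ak tk] : A (q k) /\ 0 < t k by near: k.
  split=> /=.
    have : A (q k) -> B (q k) by near: k; exact: hB.
    exact.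
  have : 0 < t k -> T (t k) by near: k; exact: hT.
  exact.
Unshelve. all: by end_near. Qed.

Lemma difference_quotientP A (q u : V) (t : R) (t0 : 0 < t) :
  difference_quotient A q t u <-> A (q + t *: u).
Proof.
have tn0 : t != 0 by rewrite gt_eqF.
split=> [[y Ay <-]|Aq].
  by rewrite scalerA divff// scale1r addrC subrK.
exists (q + t *: u) => //.
by rewrite addrAC subrr add0r scalerA mulVf// scale1r.
Qed.

Lemma regular_tangent_coneP A p w :
  regular_tangent_cone A p w <->
  forall (q : nat -> V) (t : nat -> R), q @ \oo --> p -> t @ \oo --> 0 ->
    (\forall k \near \oo, A (q k) /\ 0 < t k) ->
    exists2 u : nat -> V, u @ \oo --> w &
      \forall k \near \oo, A (q k + t k *: u k).
Proof.
split=> [h q t qp t0 At|h a].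
  have [|u [uw hu]] := h (fun k => (q k, t k)); first exact/cvg_base_point.
  exists u => //; move: At hu; apply: filterS2 => k [_ tk] /= duk.
  exact/(difference_quotientP _ _ _ tk).
have -> : a = (fun k => ((a k).1, (a k).2)) by apply/funext => k; case: (a k).
move=> /cvg_base_point[qp t0 At]; have [u uw hu] := h _ _ qp t0 At.
exists u; split=> //; move: At hu; apply: filterS2 => k [_ tk] /= Ak.
exact/(difference_quotientP _ _ _ tk).
Qed.

Lemma paratingent_coneP A p w :
  paratingent_cone A p w <->
  exists (q : nat -> V) (t : nat -> R) (u : nat -> V),
    [/\ q @ \oo --> p, t @ \oo --> 0, u @ \oo --> w &
        \forall k \near \oo, [/\ A (q k), 0 < t k & A (q k + t k *: u k)]].
Proof.
split=> [[a [u [ha uw hu]]]|[q [t [u [qp t0 uw At]]]]].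
  move: ha; rewrite (_ : a = fun k => ((a k).1, (a k).2)); last first.
    by apply/funext => k; case: (a k).
  move=> /cvg_base_point[qp t0 At].
  exists (fst \o a), (snd \o a), u; split=> //.
  move: At; apply: filterS => k [Ak tk]; split=> //.
  exact/(difference_quotientP _ _ _ tk)/hu.
case: At => N _ hN.
have sN n : (n <= n + N)%N by exact: leq_addr.
exists (fun k => (q (k + N)%N, t (k + N)%N)), (fun k => u (k + N)%N); split.
- apply/cvg_base_point; split.
  + exact: cvg_subseq sN qp.
  + exact: cvg_subseq sN t0.
  + by apply: nearW => k; have [] := hN (k + N)%N (leq_addl _ _).
- exact: cvg_subseq sN uw.
- move=> k /=; have [_ tk Ak] := hN (k + N)%N (leq_addl _ _).
  exact/(difference_quotientP _ _ _ tk).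
Qed.

Lemma regular_tangent_cone_sub A p : A p ->
  regular_tangent_cone A p `<=` paratingent_cone A p.
Proof.
move=> Ap w /regular_tangent_coneP h; apply/paratingent_coneP.
have t0 := @cvg_harmonic R.
have hp : (fun _ : nat => p) @ \oo --> p by exact: cvg_cst.
have [|u uw hu] := h _ _ hp t0.
  by apply: nearW => k; split=> //; exact: harmonic_gt0.
exists (fun=> p), harmonic, u; split=> //.
by move: hu; apply: filterS => k Ak; split=> //; exact: harmonic_gt0.
Qed.

(** Exchange the base point and the end point of each step. *)
Lemma paratingent_coneN A p w : paratingent_cone A p w ->
  paratingent_cone A p (- w).
Proof.
move=> /paratingent_coneP[q [t [u [qp t0 uw At]]]]; apply/paratingent_coneP.
exists (fun k => q k + t k *: u k), t, (fun k => - u k); split=> //.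
- exact: cvg_step qp t0 uw.
- exact: cvgN.
- move: At; apply: filterS => k [Aq tk Aqu]; split=> //.
  by rewrite scalerN addrK.
Qed.

Lemma regular_tangent_coneZ A p w c : 0 < c -> regular_tangent_cone A p w ->
  regular_tangent_cone A p (c *: w).
Proof.
move=> c0 /regular_tangent_coneP h; apply/regular_tangent_coneP => q t qp t0 At.
have ct0 : (fun k => c * t k) @ \oo --> 0.
  by rewrite -(mulr0 c); apply: cvgM => //; exact: cvg_cst.
have [|u uw hu] := h _ _ qp ct0.
  by move: At; apply: filterS => k [Ak tk]; rewrite mulr_gt0.
exists (fun k => c *: u k); first by apply: cvgZ => //; exact: cvg_cst.
by move: hu; apply: filterS => k; rewrite scalerA mulrC.
Qed.

(** After a step [t k *: u k] realizing [w], the new points of [A] still converge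
to [p], so they may serve as base points for a step realizing [w']. *)
Lemma regular_tangent_coneD A p w w' :
  regular_tangent_cone A p w -> regular_tangent_cone A p w' ->
  regular_tangent_cone A p (w + w').
Proof.
move=> /regular_tangent_coneP h /regular_tangent_coneP h'.
apply/regular_tangent_coneP => q t qp t0 At.
have [u uw hu] := h _ _ qp t0 At.
have qp' := cvg_step qp t0 uw.
have [|u' uw' hu'] := h' _ _ qp' t0.
  by move: At hu; apply: filterS2 => k [_ tk].
exists (fun k => u k + u' k); first exact: cvgD.
by move: hu'; apply: filterS => k; rewrite scalerDr addrA.
Qed.

Lemma regular_tangent_cone0 A p : regular_tangent_cone A p 0.
Proof.
apply/regular_tangent_coneP => q t qp t0 At.
exists (fun=> 0); first exact: cvg_cst.
by move: At; apply: filterS => k [Ak _]; rewrite scaler0 addr0.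
Qed.

(** The regular tangent cone is convex and the paratingent cone is symmetric,
so their coincidence makes both of them a linear subspace. *)
Lemma strict_tangent_linear A p w w' c :
  regular_tangent_cone A p = paratingent_cone A p ->
  paratingent_cone A p w -> paratingent_cone A p w' ->
  paratingent_cone A p (c *: w + w').
Proof.
move=> E Aw Aw'; rewrite -E; apply: regular_tangent_coneD; last by rewrite E.
have [c0|c0|->] := ltgtP c 0.
- rewrite -(opprK c) scaleNr -scalerN; apply: regular_tangent_coneZ.
    by rewrite oppr_gt0.
  by rewrite E; exact: paratingent_coneN.
- by apply: regular_tangent_coneZ => //; rewrite E.
- by rewrite scale0r; exact: regular_tangent_cone0.
Qed.

End cone_sequences.

(** * Strict proto-differentiability of graphs with a Lipschitz resolvent *)

Section resolvent.
Context {R : realType} {X : normedModType R} (ip : {dot X for idfun}).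
Hypotheses (hip : induces_norm ip) (hdim : finite_dimensional X).
Context (gamma : R) (gamma0 : 0 < gamma).

Definition shear (q : X * X) : X := q.1 + gamma *: q.2.

(** The inverse of [shear] on a graph whose resolvent is [P]. *)
Definition unshear (P : X -> X) (y : X) : X * X :=
  (P y, gamma^-1 *: (y - P y)).

(** When [G] is the graph of an operator [T], this says that near [p] the
resolvent of [T] with parameter [gamma], the inverse of [I + gamma T], is
single-valued and Lipschitz, and is given by [P]. *)
Definition local_resolvent (G : set (X * X)) (P : X -> X) (p : X * X) :=
  exists d L : R, [/\ 0 < d, 0 <= L,
    forall q, `|q - p| < d -> (G q <-> P (shear q) = q.1) &
    forall a b, `|a - shear p| < d -> `|b - shear p| < d ->
      `|P a - P b| <= L * `|a - b|].

Lemma shear_unshear P y : shear (unshear P y) = y.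
Proof.
by rewrite /shear /= scalerA divff ?gt_eqF// scale1r addrC subrK.
Qed.

Lemma shear_snd w : gamma^-1 *: (shear w - w.1) = w.2.
Proof.
by rewrite /shear addrAC subrr add0r scalerA mulVf ?gt_eqF// scale1r.
Qed.

Lemma unshear_shear P q : P (shear q) = q.1 -> unshear P (shear q) = q.
Proof.
by move=> E; rewrite /unshear E shear_snd; case: q {E}.
Qed.

Lemma shearD q r : shear (q + r) = shear q + shear r.
Proof. by rewrite /shear /= scalerDr addrACA. Qed.

Lemma shearZ t q : shear (t *: q) = t *: shear q.
Proof. by rewrite /shear /= scalerDr !scalerA mulrC. Qed.

Lemma shear_cvg (q : nat -> X * X) p :
  q @ \oo --> p -> (fun k => shear (q k)) @ \oo --> shear p.
Proof.
move=> qp; apply: cvgD.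
  exact: (cvg_comp _ _ qp (@cvg_fst _ _ _ _ _)).
apply: cvgZl_tmp; exact: (cvg_comp _ _ qp (@cvg_snd _ _ _ _ _)).
Qed.

Context (G : set (X * X)) (P : X -> X) (p : X * X).
Hypotheses (Gp : G p) (res : local_resolvent G P p).
Local Notation z := (shear p).

Lemma resolvent_base : P z = p.1.
Proof.
have [d [L [d0 _ hG _]]] := res.
by apply/hG => //; rewrite subrr normr0.
Qed.

Lemma near_unshear (y : nat -> X) : y @ \oo --> z ->
  (fun k => unshear P (y k)) @ \oo --> p /\
  \forall k \near \oo, G (unshear P (y k)).
Proof.
move=> yz; have [d [L [d0 L0 hG hL]]] := res.
have Py : (P \o y) @ \oo --> p.1.
  rewrite -resolvent_base; apply/cvgrPdist_lt => e e0.
  have L1 : 0 < L + 1 by rewrite ltr_wpDl.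
  have /cvgrPdist_lt yzd := yz.
  have := yzd _ d0; have := yzd _ (divr_gt0 e0 L1).
  apply: filterS2 => k; rewrite ltr_pdivlMr// => hk1 hk2 /=.
  rewrite distrC in hk1; rewrite distrC in hk2; rewrite distrC.
  have zd : `|z - z| < d by rewrite subrr normr0.
  rewrite (le_lt_trans (hL _ _ hk2 zd))// (le_lt_trans _ hk1)// mulrC.
  by rewrite ler_wpM2l// lerDl.
have cv : (fun k => unshear P (y k)) @ \oo --> p.
  rewrite -[X in _ --> X](unshear_shear resolvent_base) /unshear.
  rewrite resolvent_base; apply: cvg_pair => //.
  by apply: cvgZl_tmp; apply: cvgB.
split=> //; have /cvgrPdist_lt/(_ d d0) := cv; apply: filterS => k.
by rewrite distrC => /hG ->; rewrite shear_unshear.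
Qed.

(** In the sheared coordinates, [paratingent_cone G p] consists of the limits of
difference quotients of [P]. *)
Lemma paratingent_resolvent w : paratingent_cone G p w <->
  exists (y zeta xi : nat -> X) (t : nat -> R),
    [/\ y @ \oo --> z, t @ \oo --> 0, zeta @ \oo --> shear w,
        xi @ \oo --> w.1 &
        \forall k \near \oo,
          0 < t k /\ P (y k + t k *: zeta k) - P (y k) = t k *: xi k].
Proof.
split=> [/paratingent_coneP[q [t [u [qp t0 uw At]]]]|].
  exists (shear \o q), (shear \o u), (fst \o u), t; split=> //.
  - exact: shear_cvg.
  - exact: shear_cvg.
  - exact: (cvg_comp _ _ uw (@cvg_fst _ _ _ _ _)).
  have [d [L [d0 _ hG _]]] := res.
  have qup := cvg_step qp t0 uw.
  have /cvgrPdist_lt/(_ d d0) qpd := qp.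
  have /cvgrPdist_lt/(_ d d0) qupd := qup.
  near=> k; have [Gq tk Gqu] : [/\ G (q k), 0 < t k & G (q k + t k *: u k)].
    by near: k.
  split=> //=; rewrite -shearZ -shearD.
  have -> : P (shear (q k + t k *: u k)) = (q k + t k *: u k).1.
    by apply/hG => //; rewrite distrC; near: k.
  have -> : P (shear (q k)) = (q k).1.
    by apply/hG => //; rewrite distrC; near: k.
  by rewrite /= addrAC subrr add0r.
move=> [y [zeta [xi [t [yz t0 zw xw At]]]]]; apply/paratingent_coneP.
exists (fun k => unshear P (y k)), t,
  (fun k => (xi k, gamma^-1 *: (zeta k - xi k))).
have [cv Gy] := near_unshear yz.
have yz' := cvg_step yz t0 zw.
have [_ Gy'] := near_unshear yz'.
split=> //.
  rewrite [X in _ --> X](_ : w = (w.1, gamma^-1 *: (shear w - w.1))).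
    by apply: cvg_pair => //; apply: cvgZl_tmp; apply: cvgB.
  by rewrite shear_snd; case: (w).
near=> k; have [tk E] : 0 < t k /\
  P (y k + t k *: zeta k) - P (y k) = t k *: xi k by near: k.
split=> //; first by near: k.
have : G (unshear P (y k + t k *: zeta k)) by near: k.
congr G; rewrite /unshear; congr pair => /=.
  by rewrite -E addrCA subrr addr0.
rewrite scalerA mulrC -scalerA -scalerDr; congr (_ *: _).
by rewrite scalerBr -E opprB addrACA addKr.
Unshelve. all: by end_near. Qed.

Lemma strict_derivative_quotient D (y zeta : nat -> X) (t : nat -> R) zeta0 :
  strict_derivative P z D -> y @ \oo --> z -> t @ \oo --> 0 ->
  zeta @ \oo --> zeta0 -> (\forall k \near \oo, 0 < t k) ->
  (fun k => (t k)^-1 *: (P (y k + t k *: zeta k) - P (y k))) @ \oo --> D zeta0.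
Proof.
move=> [Dlin [M hM] est] yz t0 zz tp.
have yz' := cvg_step yz t0 zz.
have Dz := linear_bounded_cvg Dlin hM zz.
rewrite -[X in _ --> X](subrK (D zeta0)).
rewrite (_ : D zeta0 - D zeta0 = 0) ?subrr//.
rewrite (_ : (fun k => _) = (fun k => (t k)^-1 *:
  (P (y k + t k *: zeta k) - P (y k)) - D (zeta k)) \+
  (fun k => D (zeta k))); last first.
  by apply/funext => k /=; rewrite subrK.
apply: cvgD => //; apply/cvgr0Pnorm_le => e e0.
have N1 : 0 < `|zeta0| + 1 by rewrite ltr_wpDl.
have [d d0 hd] := est _ (divr_gt0 e0 N1).
have /cvgrPdist_lt/(_ d d0) yd := yz.
have /cvgrPdist_lt/(_ d d0) yd' := yz'.
have /cvgrPdist_lt/(_ 1 ltr01) zd := zz.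
near=> k; have tk : 0 < t k by near: k.
rewrite -(@ler_pM2l _ (t k))// -{1}(gtr0_norm tk) -normrZ scalerBr scalerA.
rewrite divff ?gt_eqF// scale1r -(linear_scale _ _ Dlin).
have := hd (y k + t k *: zeta k) (y k).
rewrite [_ + _ - y k]addrAC subrr add0r => h.
rewrite (le_trans (h _ _))//.
- by rewrite distrC; near: k.
- by rewrite distrC; near: k.
rewrite normrZ gtr0_norm// mulrCA ler_pM2l// mulrAC ler_pdivrMr//.
rewrite ler_pM2l//.
have : `|zeta0 - zeta k| < 1 by near: k.
have := ler_normB zeta0 (zeta0 - zeta k).
rewrite opprB addrC subrK; lra.
Unshelve. all: by end_near. Qed.

(** A paratingent direction [w] satisfies [w.1 = D (shear w)]; moving any base
point of the graph by [t k *: shear w] in the sheared coordinate then produces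
quotients converging to [w], which makes [w] a regular tangent. *)
Lemma strictly_differentiable_strict_proto :
  strictly_differentiable P z ->
  regular_tangent_cone G p = paratingent_cone G p.
Proof.
move=> [D hD]; apply/seteqP; split; first exact: regular_tangent_cone_sub.
move=> w /paratingent_resolvent[y [zeta [xi [t [yz t0 zw xw At]]]]].
have tp : \forall k \near \oo, 0 < t k by move: At; apply: filterS => k [].
have {xw} wD : w.1 = D (shear w).
  have h := strict_derivative_quotient hD yz t0 zw tp.
  apply: (norm_cvg_unique xw); apply: cvg_trans h.
  apply: near_eq_cvg; move: At; apply: filterS => k [tk ->].
  by rewrite scalerA mulVf ?gt_eqF// scale1r.
apply/regular_tangent_coneP => {y zeta xi t yz t0 zw At tp} q t qp t0 At.
have [d [L [d0 _ hG _]]] := res.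
have qz := shear_cvg qp.
have zz : (fun _ : nat => shear w) @ \oo --> shear w by exact: cvg_cst.
have tp : \forall k \near \oo, 0 < t k by move: At; apply: filterS => k [].
have h := strict_derivative_quotient hD qz t0 zz tp.
pose xi k := (t k)^-1 *: (P (shear (q k) + t k *: shear w) - P (shear (q k))).
exists (fun k => (xi k, gamma^-1 *: (shear w - xi k))).
  rewrite [X in _ --> X]
    (_ : w = (D (shear w), gamma^-1 *: (shear w - D (shear w)))).
    by apply: cvg_pair => //; apply: cvgZl_tmp; apply: cvgB.
  by rewrite -wD shear_snd; case: (w).
have yz' := cvg_step qz t0 zz.
have [_ Gy'] := near_unshear yz'.
have /cvgrPdist_lt/(_ d d0) qpd := qp.
near=> k; have [Gq tk] : G (q k) /\ 0 < t k by near: k.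
have : G (unshear P (shear (q k) + t k *: shear w)) by near: k.
have Pq : P (shear (q k)) = (q k).1.
  by apply/hG => //; rewrite distrC; near: k.
have txi : t k *: xi k = P (shear (q k) + t k *: shear w) - (q k).1.
  by rewrite scalerA divff ?gt_eqF// scale1r Pq.
congr G; rewrite /unshear -[q k in RHS](unshear_shear Pq) /unshear Pq.
congr pair => /=; first by rewrite txi addrCA subrr addr0.
rewrite scalerA mulrC -scalerA -scalerDr; congr (_ *: _).
by rewrite scalerBr txi opprB addrACA addKr.
Unshelve. all: by end_near. Qed.

(** The Lipschitz estimate survives in the limit. Consequently an element of the
cone is determined by its shear as soon as the cone is a linear subspace. *)
Lemma paratingent_resolvent_lipschitz : exists2 L : R, 0 <= L &
  forall w, paratingent_cone G p w -> `|w.1| <= L * `|shear w|.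
Proof.
have [d [L [d0 L0 _ hL]]] := res; exists L => // w.
move=> /paratingent_resolvent[y [zeta [xi [t [yz t0 zw xw At]]]]].
have yz' := cvg_step yz t0 zw.
have /cvgrPdist_lt/(_ d d0) yd := yz.
have /cvgrPdist_lt/(_ d d0) yd' := yz'.
have cl : (fun k => `|xi k|) @ \oo --> `|w.1| by exact: cvg_norm.
have cr : (fun k => L * `|zeta k|) @ \oo --> L * `|shear w|.
  by apply: cvgM; [exact: cvg_cst|exact: cvg_norm].
apply: ler_cvg_to cl cr _; near=> k.
have [tk E] : 0 < t k /\
  P (y k + t k *: zeta k) - P (y k) = t k *: xi k by near: k.
rewrite -(ler_pM2l tk) -{1}(gtr0_norm tk) -normrZ -E mulrCA.
rewrite -{2}(gtr0_norm tk) -normrZ.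
have := hL (y k + t k *: zeta k) (y k).
rewrite [_ + _ - y k]addrAC subrr add0r; apply.
- by rewrite distrC; near: k.
- by rewrite distrC; near: k.
Unshelve. all: by end_near. Qed.

(** Compactness of bounded difference quotients provides the derivative as a
cluster point; when the two cones agree the cluster point is unique and depends
linearly on the direction. *)
Lemma strict_proto_strictly_differentiable :
  regular_tangent_cone G p = paratingent_cone G p ->
  strictly_differentiable P z.
Proof.
move=> proto.
have [L L0 hL] := paratingent_resolvent_lipschitz.
have [d [M [d0 M0 _ hM]]] := res.
(* the Lipschitz bound keeps the difference quotients in a compact set *)
have cluster_pt (a b : nat -> X) : a @ \oo --> z -> b @ \oo --> z ->
    (forall k, [/\ `|a k - z| < d, `|b k - z| < d & a k != b k]) ->
    exists (phi : nat -> nat) (w : X * X), [/\ forall k, (k <= phi k)%N,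
      paratingent_cone G p w,
      (fun k => `|a (phi k) - b (phi k)|^-1 *: (a (phi k) - b (phi k)))
        @ \oo --> shear w &
      (fun k => `|a (phi k) - b (phi k)|^-1 *: (P (a (phi k)) - P (b (phi k))))
        @ \oo --> w.1].
  move=> az bz hab; pose t k := `|a k - b k|.
  have tp k : 0 < t k by have [_ _ ab] := hab k; rewrite normr_gt0 subr_eq0.
  have tk0 k : t k != 0 by rewrite gt_eqF.
  have t0 : t @ \oo --> 0.
    rewrite -(@normr0 _ X) -(subrr z); apply: cvg_norm; exact: cvgB.
  pose ze k := (t k)^-1 *: (a k - b k).
  pose xi k := (t k)^-1 *: (P (a k) - P (b k)).
  have zeM k : `|ze k| <= 1.
    by rewrite normrZ gtr0_norm ?invr_gt0// mulVf.
  have xiM k : `|xi k| <= M.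
    rewrite normrZ gtr0_norm ?invr_gt0// mulrC ler_pdivrMr//.
    by have [? ? _] := hab k; exact: hM.
  have [phi [l [hphi hl]]] := bounded_subseq hip hdim zeM.
  have [|psi [m [hpsi hm]]] := @bounded_subseq _ _ _ hip hdim (xi \o phi) M.
    by move=> k; exact: xiM.
  pose w : X * X := (m, gamma^-1 *: (l - m)).
  have sw : shear w = l.
    by rewrite /shear /= scalerA divff ?gt_eqF// scale1r addrC subrK.
  have hc k : (k <= phi (psi k))%N by rewrite (leq_trans (hpsi k)).
  have lw : (fun k => ze (phi (psi k))) @ \oo --> shear w.
    by rewrite sw; exact: cvg_subseq hpsi hl.
  exists (phi \o psi), w; split=> //; apply/paratingent_resolvent.
  exists (b \o (phi \o psi)), (ze \o (phi \o psi)), (xi \o (phi \o psi)),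
    (t \o (phi \o psi)); split => //.
  - exact: cvg_subseq hc bz.
  - exact: cvg_subseq hc t0.
  apply: nearW => k /=; rewrite !scalerA !divff// !scale1r.
  by rewrite [b _ + _]addrC subrK.
have para_inj w w' : paratingent_cone G p w -> paratingent_cone G p w' ->
    shear w = shear w' -> w.1 = w'.1.
  move=> hw hw' E.
  have := hL _ (strict_tangent_linear (-1) proto hw hw').
  rewrite shearD shearZ E !scaleN1r addNr normr0 mulr0.
  by rewrite normr_le0 /= addrC subr_eq0 => /eqP.
have ex_dir h : exists w, paratingent_cone G p w /\ shear w = h.
  have [->|h0] := eqVneq h 0.
    exists 0; split; last by rewrite /shear scaler0 addr0.
    by rewrite -proto; exact: regular_tangent_cone0.
  have hp : 0 < `|h| by rewrite normr_gt0.
  pose s (k : nat) : R := d / 2 / `|h| * harmonic k.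
  have sp k : 0 < s k.
    by apply: mulr_gt0; [rewrite !divr_gt0|exact: harmonic_gt0].
  have s0 : s @ \oo --> 0.
    rewrite -(mulr0 (d / 2 / `|h|)); apply: cvgM; first exact: cvg_cst.
    exact: cvg_harmonic.
  have [|||phi [w [_ hw hz _]]] := @cluster_pt (fun k => z + s k *: h) (fun=> z).
  - by apply: cvg_step s0 _; exact: cvg_cst.
  - exact: cvg_cst.
  - move=> k; rewrite addrAC subrr add0r normr0; split=> //.
      rewrite normrZ gtr0_norm// /s mulrAC divfK ?gt_eqF//.
      have := harmonic_gt0 k : 0 < _ :> R.
      have : harmonic k <= 1 :> R by rewrite invf_le1// ler1n.
      nra.
    by rewrite -subr_eq0 addrAC subrr add0r scaler_eq0 negb_or h0 gt_eqF.
  exists (`|h| *: w); split.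
    by rewrite -proto; apply: regular_tangent_coneZ => //; rewrite proto.
  rewrite shearZ; have -> : shear w = `|h|^-1 *: h.
    apply: (norm_cvg_unique hz).
    rewrite (_ : (fun _ => _) = fun=> `|h|^-1 *: h); first exact: cvg_cst.
    apply/funext => k; rewrite addrAC subrr add0r normrZ gtr0_norm// scalerA.
    by rewrite invfM mulrAC mulVf ?mul1r// gt_eqF.
  by rewrite scalerA divff ?scale1r// gt_eqF.
have [W hW] := choice ex_dir; pose D h := (W h).1.
have DE w : paratingent_cone G p w -> w.1 = D (shear w).
  by move=> hw; have [hw' E] := hW (shear w); apply: para_inj.
have Dlin : linear D.
  move=> c u v; have [hu Eu] := hW u; have [hv Ev] := hW v.
  have := DE _ (strict_tangent_linear c proto hu hv).
  by rewrite shearD shearZ Eu Ev => <-.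
have DM h : `|D h| <= L * `|h|.
  by have [hw {2}<-] := hW h; exact: hL.
pose DL : {linear X -> X} := HB.pack D (GRing.isLinear.Build _ _ _ _ _ Dlin).
exists D; split=> //; first by exists L.
move=> e e0; apply: contrapT => nd.
have bad k : exists ab : X * X, [/\ `|ab.1 - z| < Num.min d (harmonic k),
    `|ab.2 - z| < Num.min d (harmonic k) &
    e * `|ab.1 - ab.2| < `|P ab.1 - P ab.2 - D (ab.1 - ab.2)|].
  apply: contrapT => nab; apply: nd; exists (Num.min d (harmonic k)).
    by rewrite lt_min d0 harmonic_gt0.
  move=> a b ha hb; rewrite leNgt; apply/negP => hab; apply: nab.
  by exists (a, b).
have [ab hab] := choice bad.
have cvz (c : nat -> X) : (forall k, `|c k - z| < Num.min d (harmonic k)) ->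
    c @ \oo --> z.
  by move=> hc; apply: cvg_harmonic_dist => k;
     have := hc k; rewrite lt_min => /andP[].
have [|||phi [w [_ hw hz hx]]] := @cluster_pt (fst \o ab) (snd \o ab).
- by apply: cvz => k; have [] := hab k.
- by apply: cvz => k; have [] := hab k.
- move=> k /=; have [] := hab k; rewrite !lt_min => /andP[h1 _] /andP[h2 _] h3.
  split=> //; apply/eqP => E; move: h3.
  by rewrite E !subrr -[D]/(DL : _ -> _) linear0 subrr normr0 mulr0 ltxx.
have Dz := linear_bounded_cvg Dlin DM hz.
have dz : (fun k =>
    `|(ab (phi k)).1 - (ab (phi k)).2|^-1 *:
      (P (ab (phi k)).1 - P (ab (phi k)).2) -
    D (`|(ab (phi k)).1 - (ab (phi k)).2|^-1 *:
      ((ab (phi k)).1 - (ab (phi k)).2))) @ \oo --> (0 : X).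
  rewrite -(subrr w.1) {2}DE//; exact: cvgB.
have /cvgrPdist_lt/(_ e e0)[N _ hN] := dz.
have := hN N (leqnn N); rewrite sub0r normrN; have [_ _] := hab (phi N).
set a := (ab (phi N)).1; set b := (ab (phi N)).2 => h1.
rewrite /= -/a -/b (linear_scale _ _ Dlin) -scalerBr normrZ normfV normr_id.
have ab0 : 0 < `|a - b|.
  rewrite normr_gt0; apply/eqP => /eqP; rewrite subr_eq0 => /eqP E; move: h1.
  by rewrite E !subrr -[D]/(DL : _ -> _) linear0 subrr normr0 mulr0 ltxx.
rewrite mulrC ltr_pdivrMr// => h2.
by have := lt_trans h1 h2; rewrite ltxx.
Qed.

End resolvent.

(** * Subgradient inequalities *)

Section normal_cones.
Context {R : realType} {V : normedModType R}.

Lemma tangent_coneP (A : set V) x w : tangent_cone A x w ->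
  exists (t : nat -> R) (u : nat -> V),
    [/\ t @ \oo --> 0, u @ \oo --> w &
        \forall k \near \oo, 0 < t k /\ A (x + t k *: u k)].
Proof.
move=> [t [u [t0 uw hu]]]; exists t, u; split=> //.
  exact: cvg_trans t0 (cvg_within _).
have : \forall k \near \oo, 0 < t k.
  by apply: (t0 [set s | 0 < s]); exact: nbhs_right_gt.
by apply: filterS => k tk; split=> //; exact/(difference_quotientP _ _ _ tk).
Qed.

(** The whole segment from [x] to [y] lies in [A]. *)
Lemma convex_tangent_cone (A : set V) x y :
  convex_set A -> A x -> A y -> tangent_cone A x (y - x).
Proof.
move=> cA Ax Ay; exists harmonic, (fun=> y - x); split.
- move=> B [e /= e0 hB]; have /cvgrPdist_lt/(_ e e0) := @cvg_harmonic R.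
  by apply: filterS => k hk; apply: hB => //=; exact: harmonic_gt0.
- exact: cvg_cst.
move=> k; apply/(difference_quotientP _ _ _ (harmonic_gt0 k)).
have h0 : 0 <= harmonic k :> R by exact: harmonic_ge0.
have h1 : harmonic k <= 1 :> R by rewrite invf_le1// ler1n.
have := cA y x (Itv01 h0 h1); rewrite !inE => /(_ Ay Ax).
congr A; rewrite [LHS]/(harmonic k *: y + (1 - harmonic k) *: x).
by rewrite scalerBl scale1r scalerBr addrCA.
Qed.

End normal_cones.

Section subgradients.
Context {R : realType} {X : normedModType R} (ip : {dot X for idfun}).
Hypothesis hip : induces_norm ip.
Context (f : X -> \bar R).

Lemma ip_cvg (u v : nat -> X) (a b : X) : u @ \oo --> a -> v @ \oo --> b ->
  (fun k => ip (u k) (v k)) @ \oo --> ip a b.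
Proof.
move=> ua vb.
have polar_id x y : ip x y = (`|x + y| * `|x + y| - `|x - y| * `|x - y|) / 4.
  by rewrite -!expr2 (normD_sqr hip) (normB_sqr hip); field.
under eq_fun do rewrite polar_id; rewrite polar_id.
apply: cvgM; last exact: cvg_cst.
by apply: cvgB; apply: cvgM; apply: cvg_norm;
   [exact: cvgD..|exact: cvgB|exact: cvgB].
Qed.

(** A quadratic minorant touching [f] at [x] makes [(v, -1)] a regular normal to
the epigraph, since the quadratic term is negligible along tangent sequences. *)
Lemma proximal_subgradient x v (s : R) : f x \is a fin_num ->
  (forall y, (f x + (ip v (y - x) - s / 2 * `|y - x| ^+ 2)%:E <= f y)%E) ->
  subdifferential ip f x v.
Proof.
move=> fx hs; split=> //.
exists (fun=> (x, fine (f x))), (fun=> (v, -1)); split; [exact: cvg_cst..|].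
move=> _; split; first by rewrite /epigraph /= fineK.
move=> [h b] /tangent_coneP[t [u [t0 uw At]]].
have uh : (fst \o u) @ \oo --> h.
  exact: (cvg_comp _ _ uw (@cvg_fst _ _ _ _ _)).
have ub : (snd \o u) @ \oo --> b.
  exact: (cvg_comp _ _ uw (@cvg_snd _ _ _ _ _)).
rewrite /prod_ip /= mulN1r subr_le0.
have cl : (fun k => ip v (u k).1 - s / 2 * (t k * (`|(u k).1| * `|(u k).1|)))
    @ \oo --> ip v h.
  rewrite -[X in _ --> X]subr0 -(mulr0 (s / 2)) -(mul0r (`|h| * `|h|)).
  apply: cvgB; first by apply: ip_cvg => //; exact: cvg_cst.
  apply: cvgM; first exact: cvg_cst.
  by apply: cvgM => //; apply: cvgM; exact: cvg_norm.
apply: ler_cvg_to cl ub _; move: At; apply: filterS => k [tk].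
rewrite /epigraph /= => hk; rewrite -(ler_pM2l tk).
have := le_trans (hs _) hk; rewrite -{1}(fineK fx) -EFinD lee_fin lerD2l.
rewrite addrAC subrr add0r normrZ gtr0_norm// ipZr => h1.
by apply: le_trans h1; rewrite le_eqVlt; apply/orP; left; apply/eqP; ring.
Qed.

(** A regular normal to a convex epigraph is a normal in the sense of convex
analysis, and this global inequality passes to limits of normals. *)
Lemma convex_subgradient x v : convex_ereal f -> subdifferential ip f x v ->
  forall y, (f x + (ip v (y - x))%:E <= f y)%E.
Proof.
move=> cf [fx [xk [vk [xx vv hk]]]] y.
have main b : (f y <= b%:E)%E -> fine (f x) + ip v (y - x) <= b.
  move=> yb.
  have hle k : prod_ip ip (vk k) ((y, b) - xk k) <= 0.
    have [Ek Nk] := hk k; apply: Nk.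
    by apply: convex_tangent_cone.
  have : (fun k => prod_ip ip (vk k) ((y, b) - xk k)) @ \oo -->
      ip v (y - x) + -1 * (b - fine (f x)).
    have x1 : (fst \o xk) @ \oo --> x.
      exact: (cvg_comp _ _ xx (@cvg_fst _ _ _ _ _)).
    have x2 : (snd \o xk) @ \oo --> fine (f x).
      exact: (cvg_comp _ _ xx (@cvg_snd _ _ _ _ _)).
    have v1 : (fst \o vk) @ \oo --> v.
      exact: (cvg_comp _ _ vv (@cvg_fst _ _ _ _ _)).
    have v2 : (snd \o vk) @ \oo --> (-1 : R).
      exact: (cvg_comp _ _ vv (@cvg_snd _ _ _ _ _)).
    apply: cvgD.
      by apply: ip_cvg => //; apply: cvgB => //; exact: cvg_cst.
    by apply: cvgM => //; apply: cvgB => //; exact: cvg_cst.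
  move=> /ler_cvg_to/(_ (@cvg_cst _ (0 : R) _ _ _)) => h.
  have : ip v (y - x) + -1 * (b - fine (f x)) <= 0 by apply: h; exact: nearW.
  lra.
rewrite -(fineK fx) -EFinD.
case: (f y) main => [b||] main.
- by rewrite lee_fin; exact: main.
- exact: leey.
- have h := main (fine (f x) + ip v (y - x) - 1)%R (leNye _).
  by exfalso; move: h; lra.
Qed.

Context (xb vb : X).

(** Subdifferential continuity makes the condition on function values in the
definition of prox-regularity automatic. *)
Lemma subdifferentially_continuous_lt (e : R) : 0 < e -> f xb \is a fin_num ->
  subdifferentially_continuous ip f xb vb ->
  exists2 d : R, 0 < d & forall x v, subdifferential ip f x v ->
    `|x - xb| < d -> `|v - vb| < d -> (f x < f xb + e%:E)%E.
Proof.
move=> e0 fxb hc; apply: contrapT => nd.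
have bad k : exists xv : X * X, [/\ subdifferential ip f xv.1 xv.2,
    `|xv.1 - xb| < harmonic k, `|xv.2 - vb| < harmonic k &
    ~ (f xv.1 < f xb + e%:E)%E].
  apply: contrapT => nx; apply: nd; exists (harmonic k).
    exact: harmonic_gt0.
  move=> x v hxv hx hv; apply: contrapT => nlt; apply: nx.
  by exists (x, v).
have [xv hxv] := choice bad.
have cf : (f \o (fst \o xv)) @ \oo --> f xb.
  apply: (hc _ (snd \o xv)).
  - by apply: cvg_harmonic_dist => k; have [] := hxv k.
  - by apply: cvg_harmonic_dist => k; have [] := hxv k.
  - by move=> k; have [] := hxv k.
have nb : nbhs (f xb) [set y | (y < f xb + e%:E)%E].
  apply: open_nbhs_nbhs; split; first exact: open_ereal_lt_ereal.
  by rewrite /= -(fineK fxb) -EFinD lte_fin ltrDl.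
have [N _ hN] := cf _ nb; have [_ _ _] := hxv N; apply.
exact: (hN N (leqnn N)).
Qed.

(** Prox-boundedness dominates the quadratic minorant far from [xb] once the
modulus is large, so the local inequality of prox-regularity becomes global. *)
Lemma prox_regular_global :
  prox_regular ip f xb vb -> subdifferentially_continuous ip f xb vb ->
  prox_bounded f ->
  exists d r : R, [/\ 0 < d, 0 <= r &
    forall x v, subdifferential ip f x v -> `|x - xb| < d -> `|v - vb| < d ->
      forall y, (f x + (ip v (y - x) - r / 2 * `|y - x| ^+ 2)%:E <= f y)%E].
Proof.
move=> [fxb _ _ [e [r1 [e0 r10 hr1]]]] hc [a [m hm]].
have [d1 d10 hd1] := subdifferentially_continuous_lt e0 fxb hc.
(* outside the ball of radius [e] around [xb] one has [1 <= 2 / e * `|y - x|], so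
   every lower-order term is bounded by a multiple of [`|y - x| ^+ 2] *)
pose C := `|fine (f xb) + e - m|; pose B := `|xb| + e; pose K := `|vb| + e.
pose r := r1 + 2 * (C * (2 / e) ^+ 2 + K * (2 / e) +
                    `|a| * (B * (2 / e) + 1) ^+ 2).
have B0 : 0 <= B by rewrite addr_ge0// ltW.
have K0 : 0 <= K by rewrite addr_ge0// ltW.
have ie0 : 0 < 2 / e by rewrite divr_gt0.
have rr1 : r1 <= r.
  have q1 : 0 <= C * (2 / e) ^+ 2 by rewrite mulr_ge0 ?sqr_ge0 ?normr_ge0.
  have q2 : 0 <= K * (2 / e) by rewrite mulr_ge0// ltW.
  have q3 : 0 <= `|a| * (B * (2 / e) + 1) ^+ 2 by rewrite mulr_ge0 ?sqr_ge0.
  rewrite /r; lra.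
exists (Num.min d1 (e / 2)), r; split.
- by rewrite lt_min d10 divr_gt0.
- exact: le_trans rr1.
move=> x v hxv; rewrite !lt_min => /andP[x1 x2] /andP[v1 v2] y.
have fx : f x \is a fin_num by case: hxv.
have fxe := hd1 x v hxv x1 v1.
have [ye|ye] := leP `|y - xb| e.
  apply: le_trans (hr1 x v hxv _ fxe y ye).
    by rewrite leeD2l// lee_fin lerD2l lerN2 ler_wpM2r ?sqr_ge0// ler_wpM2r.
  rewrite -[leRHS]ger0_norm ?(ltW e0)// -sqrtr_sqr ler_wsqrtr//.
  have := normr_ge0 (x - xb); have := normr_ge0 (v - vb).
  rewrite !expr2; nra.
pose s := `|y - x|.
have s_gt : e / 2 < s.
  have := ler_normD (y - x) (x - xb); rewrite addrA subrK; rewrite -/s; lra.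
have s0 : 0 < s by lra.
have vK : `|v| <= K.
  have := ler_normD (v - vb) vb; rewrite subrK /K; lra.
have yB : `|y| <= B + s.
  have := ler_normD (y - x) x; rewrite subrK.
  have := ler_normD (x - xb) xb; rewrite subrK /B -/s; lra.
have ks : 1 <= 2 / e * s by rewrite mulrAC ler_pdivlMr// mul1r; lra.
have ipK : ip v (y - x) <= K * s.
  by rewrite (le_trans (ip_le hip _ _))// ler_wpM2r.
have aB : a * `|y| ^+ 2 <= `|a| * (B + s) ^+ 2.
  rewrite (@le_trans _ _ (`|a| * `|y| ^+ 2))//.
    by rewrite ler_wpM2r ?sqr_ge0// ler_norm.
  by rewrite ler_wpM2l// lerXn2r// nnegrE ?normr_ge0// addr_ge0// ltW.
have fxC : fine (f x) - m <= C.
  rewrite (le_trans _ (ler_norm _))// lerB//.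
  by move: fxe; rewrite -(fineK fx) -(fineK fxb) -EFinD lte_fin => /ltW.
have t1 : C <= C * (2 / e) ^+ 2 * s ^+ 2.
  by rewrite -mulrA -exprMn ler_peMr ?normr_ge0// exprn_ege1.
have t2 : K * s <= K * (2 / e) * s ^+ 2.
  by rewrite -mulrA ler_wpM2l// expr2 mulrA ler_peMl// ltW.
have t3 : `|a| * (B + s) ^+ 2 <= `|a| * (B * (2 / e) + 1) ^+ 2 * s ^+ 2.
  have Bs : 0 <= B + s by rewrite addr_ge0// ltW.
  have BsX : B + s <= (B * (2 / e) + 1) * s.
    by rewrite mulrDl mul1r lerD2r -mulrA ler_peMr.
  rewrite -mulrA ler_wpM2l// -exprMn lerXn2r// nnegrE.
  exact: le_trans BsX.
have := hm y; move: (f y) => [b||]; last 1 first.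
- by rewrite leeNy_eq.
- rewrite -(fineK fx) -!EFinD !lee_fin => hb.
  have rs : r1 / 2 * s ^+ 2 >= 0 by rewrite mulr_ge0 ?sqr_ge0// divr_ge0.
  rewrite -/s.
  have -> : r / 2 * s ^+ 2 = r1 / 2 * s ^+ 2 + C * (2 / e) ^+ 2 * s ^+ 2 +
    K * (2 / e) * s ^+ 2 + `|a| * (B * (2 / e) + 1) ^+ 2 * s ^+ 2.
    by rewrite /r; field; rewrite gt_eqF.
  lra.
- by move=> _; exact: leey.
Qed.

End subgradients.

(** * The proximal mapping and the envelope *)

Section proximal_mapping.
Context {R : realType} {X : normedModType R} (ip : {dot X for idfun}).
Hypotheses (hip : induces_norm ip) (hdim : finite_dimensional X).
Context (f : X -> \bar R) (xb vb : X) (gamma r d : R).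
Hypotheses (gamma0 : 0 < gamma) (gr : gamma * r < 1) (d0 : 0 < d).
Hypothesis hglob : forall x v, subdifferential ip f x v ->
  `|x - xb| < d -> `|v - vb| < d ->
  forall y, (f x + (ip v (y - x) - r / 2 * `|y - x| ^+ 2)%:E <= f y)%E.
Hypotheses (hvb : subdifferential ip f xb vb) (hlsc : locally_lsc f xb).

Local Notation zb := (xb + gamma *: vb).
Local Notation phi := (prox_objective gamma f).

(** The coefficient of the quadratic term that remains once the coefficient
[1 / (2 * gamma)] of the objective has absorbed the defect [r / 2] of [f]. *)
Definition growth : R := (gamma^-1 - r) / 2.

Lemma growth_gt0 : 0 < growth.
Proof.
by rewrite divr_gt0// subr_gt0 -(ltr_pM2l gamma0) divff ?gt_eqF.
Qed.

(** Expanding the squares, the linear terms cancel exactly when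
[z = x + gamma *: v]; otherwise they leave the inner product on the left. *)
Lemma prox_objective_growth x v z w : subdifferential ip f x v ->
  `|x - xb| < d -> `|v - vb| < d ->
  (phi z x + (growth * `|w - x| ^+ 2 -
              gamma^-1 * ip (w - x) (z - (x + gamma *: v)))%:E <= phi z w)%E.
Proof.
move=> hxv hx hv; have [fx _] := hxv; have := hglob hxv hx hv w.
rewrite /prox_objective -(fineK fx); case: (f w) => [b||]; last 2 first.
- by move=> _; rewrite addye// leey.
- by rewrite leeNy_eq.
rewrite -!EFinD !lee_fin => h.
have E : `|w - z| ^+ 2 = `|w - x| ^+ 2 - 2 * ip (w - x) (z - x) + `|x - z| ^+ 2.
  have -> : w - z = (w - x) - (z - x) by rewrite opprB addrA subrK.
  by rewrite (normB_sqr hip) (distrC z x).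
have E2 : ip (w - x) (z - (x + gamma *: v)) =
    ip (w - x) (z - x) - gamma * ip v (w - x).
  by rewrite opprD addrA ipBr ipZr (ipC ip v).
rewrite E E2 /growth -subr_ge0.
move: h; rewrite -subr_ge0 => /le_trans; apply; rewrite le_eqVlt.
apply/orP; left; apply/eqP; field; exact: lt0r_neq0.
Qed.

Lemma prox_objective_fin z : phi z xb \is a fin_num.
Proof. by have [fx _] := hvb; rewrite fin_numD fx. Qed.

Lemma prox_objective_near z w :
  (phi z xb + (growth * `|w - xb| ^+ 2 -
               gamma^-1 * (`|w - xb| * `|z - zb|))%:E <= phi z w)%E.
Proof.
have := @prox_objective_growth xb vb z w hvb.
rewrite !subrr normr0 => /(_ d0 d0).
apply: le_trans; rewrite leeD2l// lee_fin lerD2l lerN2.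
rewrite ler_wpM2l ?invr_ge0 ?(ltW gamma0)//.
exact: (ip_le hip).
Qed.

(** Minimizers at parameters close to [zb] exist and are close to [xb]: the
quadratic growth confines the minimization to a small ball, which is compact,
and there the relevant sublevel sets of [f] are closed. *)
Lemma exists_prox (rho0 : R) : 0 < rho0 -> exists2 eta : R, 0 < eta &
  forall z, `|z - zb| < eta ->
    exists2 w, prox gamma f z w & `|w - xb| <= rho0.
Proof.
move=> rho00; have [e e0 lsc] := hlsc; have [fxb _] := hvb.
have c0 := growth_gt0.
have B0 : 0 < 2 * gamma * `|vb| + 3 by rewrite ltr_wpDl// !mulr_ge0// ltW.
(* the radius is so small that minimizing sequences in the ball have values of [f]
   eventually below [f xb + e], where the sublevel sets of [f] are closed *)
pose rho := Num.min (Num.min 1 e)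
  (Num.min rho0 (e * gamma / (2 * gamma * `|vb| + 3))).
have rho_gt0 : 0 < rho by rewrite !lt_min ltr01 e0 rho00 divr_gt0// mulr_gt0.
have [rho1 rhoe rhor rhoB] : [/\ rho <= 1, rho <= e, rho <= rho0 &
    rho * (2 * gamma * `|vb| + 3) <= e * gamma].
  rewrite -(ler_pdivlMr _ _ B0).
  by split; rewrite /rho !ge_min ?lexx ?orTb ?orbT ?orbT.
exists (Num.min 1 (rho * (gamma * growth))).
  by rewrite lt_min ltr01 mulr_gt0// mulr_gt0.
move=> z; rewrite lt_min => /andP[z1 zr].
have out w : rho <= `|w - xb| -> (phi z xb <= phi z w)%E.
  move=> hw; apply: le_trans (prox_objective_near z w).
  rewrite leeDl// lee_fin subr_ge0 expr2.
  rewrite ![_ * (`|w - xb| * _)]mulrCA ler_wpM2l//.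
  rewrite -(ler_pM2l gamma0) mulrA divff ?gt_eqF// mul1r.
  rewrite (le_trans (ltW zr))// [leRHS]mulrA mulrC ler_wpM2l//.
  by rewrite ltW// mulr_gt0.
pose A := [set a : R | exists2 w, `|w - xb| <= rho & (phi z w <= a%:E)%E].
have A_xb : A (fine (phi z xb)).
  exists xb; first by rewrite subrr normr0 ltW.
  by rewrite fineK// prox_objective_fin.
have A_lb : lbound A (fine (phi z xb) - gamma^-1 * rho).
  move=> a [w hw]; move: (prox_objective_near z w) => /le_trans h /h.
  rewrite -(fineK (prox_objective_fin z)) -EFinD lee_fin; apply: le_trans.
  rewrite lerD2l /= -subr_ge0 opprK addrC.
  have : gamma^-1 * (`|w - xb| * `|z - zb|) <= gamma^-1 * rho.
    rewrite ler_wpM2l ?invr_ge0 ?(ltW gamma0)// (le_trans _ hw)//.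
    by rewrite ler_piMr// ltW.
  have : 0 <= growth * `|w - xb| ^+ 2 by rewrite mulr_ge0 ?sqr_ge0// ltW.
  lra.
have A_inf : has_inf A.
  by split; [exists (fine (phi z xb))|exists (fine (phi z xb) - gamma^-1 * rho)].
set m := inf A.
have min_seq k : exists w,
    `|w - xb| <= rho /\ (phi z w <= (m + harmonic k)%:E)%E.
  have [a [w hw wa] am] :=
    inf_adherent (harmonic_gt0 k : 0 < harmonic k :> R) A_inf.
  exists w; split=> //; apply: (le_trans wa).
  by rewrite lee_fin ltW.
have [u hu] := choice min_seq.
have [|psi [w [hpsi uw]]] := @bounded_subseq _ _ _ hip hdim u (`|xb| + rho).
  move=> k; have [hk _] := hu k.
  by have := ler_normD (u k - xb) xb; rewrite subrK; lra.
have w_rho : `|w - xb| <= rho.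
  have h : (fun k => `|u (psi k) - xb|) @ \oo --> `|w - xb|.
    by apply: cvg_norm; apply: cvgB => //; exact: cvg_cst.
  have c : (fun _ : nat => rho) @ \oo --> rho by exact: cvg_cst.
  by apply: ler_cvg_to h c _; apply: nearW => k; have [] := hu (psi k).
pose beta := m - (2 * gamma)^-1 * `|w - z| ^+ 2.
have m_xb : m <= fine (phi z xb) by apply: ge_inf => //; case: A_inf.
have ig0 : 0 < (2 * gamma)^-1 by rewrite invr_gt0 mulr_gt0.
have beta_e : beta < fine (f xb) + e.
  have : fine (phi z xb) = fine (f xb) + (2 * gamma)^-1 * `|xb - z| ^+ 2.
    by rewrite /prox_objective -(fineK fxb) -EFinD.
  have h1 : `|xb - z| <= gamma * `|vb| + 1.
    have -> : xb - z = - (z - zb) - gamma *: vb.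
      by rewrite opprB addrAC addrK.
    rewrite (le_trans (ler_normB _ _))// normrN normrZ gtr0_norm// addrC.
    by rewrite lerD2l ltW.
  have h2 : `|xb - z| <= rho + `|w - z|.
    have := ler_normD (xb - w) (w - z); rewrite addrA subrK (distrC xb w).
    by move=> /le_trans; apply; rewrite lerD2r.
  have h3 : `|xb - z| ^+ 2 - `|w - z| ^+ 2 < 2 * gamma * e.
    have h4 : `|xb - z| ^+ 2 - `|w - z| ^+ 2 <= 2 * rho * `|xb - z|.
      have sq (p q : R) : 0 <= p -> 0 <= q -> p <= rho + q ->
          p * p - q * q <= 2 * rho * p by have [pq|qp] := leP p q; nra.
      by rewrite !expr2 sq.
    rewrite (le_lt_trans h4)//.
    rewrite (@le_lt_trans _ _ (2 * rho * (gamma * `|vb| + 1)))//.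
      by rewrite ler_wpM2l// mulr_ge0// ltW.
    nra.
  have : (2 * gamma)^-1 * (`|xb - z| ^+ 2 - `|w - z| ^+ 2) < e.
    by rewrite mulrC ltr_pdivrMr ?mulr_gt0// mulrC.
  rewrite /beta; lra.
have f_le a : beta < a -> a <= fine (f xb) + e -> (f w <= a%:E)%E.
  move=> ba ae.
  have cl : closed [set y | `|y - xb| <= e /\ (f y <= a%:E)%E].
    by apply: lsc; rewrite -(fineK fxb) -EFinD lee_fin.
  suff : [set y | `|y - xb| <= e /\ (f y <= a%:E)%E] w by case.
  have uw' := uw; apply: (closed_cvg _ cl) uw'.
  have hc : (fun k => m + harmonic (psi k) - (2 * gamma)^-1 *
      (`|u (psi k) - z| * `|u (psi k) - z|)) @ \oo --> beta.
    rewrite /beta -[X in X - _]addr0; apply: cvgB.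
      apply: cvgD; first exact: cvg_cst.
      exact: cvg_subseq hpsi (@cvg_harmonic R).
    apply: cvgM; first exact: cvg_cst.
    rewrite expr2; apply: cvgM; apply: cvg_norm.
      by apply: cvgB; [exact: uw|exact: cvg_cst].
    by apply: cvgB; [exact: uw|exact: cvg_cst].
  have : \forall k \near \oo, m + harmonic (psi k) - (2 * gamma)^-1 *
      (`|u (psi k) - z| * `|u (psi k) - z|) < a.
    by apply: (hc [set s | s < a]); exact: lt_nbhsl.
  apply: filterS => k hk /=; have [hk1 hk2] := hu (psi k).
  split; first exact: le_trans rhoe.
  move: hk2; rewrite /prox_objective.
  case: (f (u (psi k))) => [b||] //; last by move=> _; exact: leNye.
  rewrite -EFinD !lee_fin expr2; move: hk => /=.
  set t := _^-1 * _; set s := _%:R^-1; lra.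
have f_beta : (f w <= beta%:E)%E.
  move: f_le; case: (f w) => [b||] f_le.
  - rewrite lee_fin leNgt; apply/negP => bb.
    have := f_le (Num.min ((b + beta) / 2) (fine (f xb) + e)).
    rewrite lt_min beta_e andbT ge_min lexx orbT lee_fin le_min.
    have -> : beta < (b + beta) / 2 by lra.
    by move=> /(_ isT isT) /andP[h _]; move: h; lra.
  - by have := f_le _ beta_e (lexx _).
  - exact: leNye.
have phi_m : (phi z w <= m%:E)%E.
  have -> : m = beta + (2 * gamma)^-1 * `|w - z| ^+ 2 by rewrite /beta subrK.
  by rewrite EFinD /prox_objective leeD2r.
exists w; last exact: le_trans rhor.
move=> w'; apply: (le_trans phi_m).
have [w'r|/ltW w'r] := leP `|w' - xb| rho; last first.
  apply: le_trans (out _ w'r).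
  by rewrite -(fineK (prox_objective_fin z)) lee_fin.
have := prox_objective_near z w'.
rewrite -(fineK (prox_objective_fin z)) -EFinD.
case E : (phi z w') => [b||] h;
  [|exact: leey|by move: h; rewrite leeNy_eq].
rewrite lee_fin; apply: ge_inf; first by case: A_inf.
by exists w' => //; rewrite E.
Qed.

(** Minimality of [w] is a quadratic minorant of [f] touching at [w]. *)
Lemma prox_subgradient z w : prox gamma f z w ->
  subdifferential ip f w (gamma^-1 *: (z - w)).
Proof.
move=> hw.
have fw : f w \is a fin_num.
  have := hw xb; have := prox_objective_near z w.
  rewrite -(fineK (prox_objective_fin z)) -EFinD /prox_objective.
  by case: (f w) => [b||].
apply: (@proximal_subgradient _ _ _ hip _ _ _ gamma^-1) => // y.
have := hw y; rewrite /prox_objective -(fineK fw).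
case: (f y) => [b||]; rewrite ?leey//.
rewrite -!EFinD !lee_fin => h.
have E : `|y - z| ^+ 2 = `|y - w| ^+ 2 - 2 * ip (y - w) (z - w) + `|w - z| ^+ 2.
  have -> : y - z = (y - w) - (z - w) by rewrite opprB addrA subrK.
  by rewrite (normB_sqr hip) (distrC z w).
rewrite ipZl (ipC ip _ (y - w)) -subr_ge0; move: h; rewrite E -subr_ge0.
move=> /le_trans; apply; rewrite le_eqVlt; apply/orP; left; apply/eqP; field.
exact: lt0r_neq0.
Qed.

Lemma prox_graph_point x v : subdifferential ip f x v ->
  `|x - xb| < d -> `|v - vb| < d -> prox gamma f (x + gamma *: v) = [set x].
Proof.
move=> hxv hx hv.
have h w := prox_objective_growth (x + gamma *: v) w hxv hx hv.
have fp : phi (x + gamma *: v) x \is a fin_num.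
  by have [fx _] := hxv; rewrite fin_numD fx.
apply/seteqP; split=> [w hw|_ ->] /=.
- have := le_trans (h w) (hw x).
  rewrite subrr (ipC ip _ 0) ip0l mulr0 subr0 -(fineK fp) -EFinD lee_fin.
  rewrite gerDl pmulr_rle0 ?growth_gt0// => wx.
  by apply/eqP; rewrite -subr_eq0 -normr_eq0 -sqrf_eq0 eq_le wx sqr_ge0.
- move=> w; apply: le_trans (h w).
  rewrite subrr (ipC ip _ 0) ip0l mulr0 subr0 leeDl// lee_fin.
  by rewrite mulr_ge0 ?sqr_ge0// ltW// growth_gt0.
Qed.

Lemma residual_offset z w :
  gamma^-1 *: (z - w) - vb = gamma^-1 *: ((z - zb) - (w - xb)).
Proof.
have -> : z - zb - (w - xb) = z - w - gamma *: vb.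
  by rewrite opprB opprD -addrA [- xb - _]addrC subrKA addrA addrAC.
by rewrite [RHS]scalerBr scalerA mulVf ?gt_eqF// scale1r.
Qed.

Definition prox_selection (P : X -> X) (eta : R) :=
  forall z, `|z - zb| < eta -> [/\ prox gamma f z = [set P z],
    subdifferential ip f (P z) (gamma^-1 *: (z - P z)),
    `|P z - xb| < d & `|gamma^-1 *: (z - P z) - vb| < d].

(** The point [w] minimizing at [z] carries the subgradient
[gamma^-1 *: (z - w)], which is close to [vb] when [z] and [w] are close to [zb]
and [xb]; the growth inequality at this graph point then gives uniqueness. *)
Lemma exists_prox_selection : exists (P : X -> X) (eta : R),
  0 < eta /\ prox_selection P eta.
Proof.
have rho0 : 0 < Num.min d (gamma * d) / 2.
  by rewrite divr_gt0// lt_min d0 mulr_gt0.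
have [eta eta0 heta] := exists_prox rho0.
have hP z : exists w, `|z - zb| < eta ->
    prox gamma f z w /\ `|w - xb| <= Num.min d (gamma * d) / 2.
  have [/heta[w pw wx]|] := ltP `|z - zb| eta; first by exists w.
  by move=> _; exists z.
have [P {}hP] := choice hP.
exists P, (Num.min eta (gamma * d / 2)); split.
  by rewrite lt_min eta0 divr_gt0// mulr_gt0.
move=> z; rewrite lt_min => /andP[ze zd]; have [pz Pz] := hP z ze.
have hd : Num.min d (gamma * d) <= d by rewrite ge_min lexx.
have hgd : Num.min d (gamma * d) <= gamma * d by rewrite ge_min lexx orbT.
have sg := prox_subgradient pz.
have P1 : `|P z - xb| < d by lra.
have P2 : `|gamma^-1 *: (z - P z) - vb| < d.
  rewrite residual_offset.
  rewrite normrZ gtr0_norm ?invr_gt0// mulrC ltr_pdivrMr// (mulrC d).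
  rewrite (le_lt_trans (ler_normB _ _))//; lra.
split=> //; rewrite -(prox_graph_point sg P1 P2) scalerA divff ?gt_eqF//.
by rewrite scale1r addrC subrK.
Qed.

Context (P : X -> X) (eta : R) (eta0 : 0 < eta) (hP : prox_selection P eta).

(** Adding the minorants at the two graph points shows that the subdifferential
plus [r] times the identity is monotone there. *)
Lemma selection_lipschitz a b : `|a - zb| < eta -> `|b - zb| < eta ->
  `|P a - P b| <= (1 - gamma * r)^-1 * `|a - b|.
Proof.
move=> /hP[_ sa Pa va] /hP[_ sb Pb vb'].
have [fa _] := sa; have [fb _] := sb.
have := hglob sa Pa va (P b); have := hglob sb Pb vb' (P a).
rewrite -(fineK fa) -(fineK fb) -!EFinD !lee_fin (distrC (P b)) => h1 h2.
have mono : - r * `|P a - P b| ^+ 2 <=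
    ip (gamma^-1 *: (a - P a) - gamma^-1 *: (b - P b)) (P a - P b).
  rewrite ipBl; move: h1 h2; rewrite -(opprB (P a) (P b)) (ipC ip _ (- _)) ipNl.
  rewrite (ipC ip (P a - P b)); lra.
have E : ip (gamma^-1 *: (a - P a) - gamma^-1 *: (b - P b)) (P a - P b) =
    gamma^-1 * (ip (a - b) (P a - P b) - `|P a - P b| ^+ 2).
  by rewrite -scalerBr ipZl hip -ipBl; congr (_ * ip _ _);
     rewrite opprB opprB addrACA [RHS]addrACA; congr (_ + _); rewrite addrC.
have h3 : (1 - gamma * r) * `|P a - P b| ^+ 2 <= ip (a - b) (P a - P b).
  move: mono; rewrite E -(ler_pM2l gamma0) [leRHS]mulrA divff ?gt_eqF// mul1r.
  lra.
have g1 : 0 < 1 - gamma * r by rewrite subr_gt0.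
have [->|n0] := eqVneq (P a - P b) 0.
  by rewrite normr0 mulr_ge0// invr_ge0 ltW.
have np : 0 < `|P a - P b| by rewrite normr_gt0.
rewrite mulrC ler_pdivlMr// -(ler_pM2r np) mulrAC -expr2 mulrC.
exact: le_trans h3 (ip_le hip _ _).
Qed.

Lemma selection_zb : P zb = xb.
Proof.
have [E _ _ _] : [/\ prox gamma f zb = [set P zb],
    subdifferential ip f (P zb) (gamma^-1 *: (zb - P zb)),
    `|P zb - xb| < d & `|gamma^-1 *: (zb - P zb) - vb| < d].
  by apply: hP; rewrite subrr normr0.
have : [set P zb] xb by rewrite -E prox_graph_point// subrr normr0.
by [].
Qed.

Lemma shear_lipschitz (q p : X * X) :
  `|shear gamma q - shear gamma p| <= (1 + gamma) * `|q - p|.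
Proof.
have h1 : `|q.1 - p.1| <= `|q - p| by rewrite [leRHS]prod_normE le_max lexx.
have h2 : `|q.2 - p.2| <= `|q - p|.
  by rewrite [leRHS]prod_normE le_max lexx orbT.
rewrite /shear opprD addrACA -scalerBr (le_trans (ler_normD _ _))//.
by rewrite normrZ gtr0_norm// mulrDl mul1r lerD// ler_wpM2l// ltW.
Qed.

(** Near [(xb, vb)] the graph of the subdifferential is the graph of [P] in
sheared coordinates. *)
Lemma selection_local_resolvent : \forall p \near (xb, vb),
  local_resolvent gamma (graph (subdifferential ip f)) P p.
Proof.
have g1 : 0 < 1 + gamma by rewrite addr_gt0.
have g2 : 0 < 1 - gamma * r by rewrite subr_gt0.
have D0 : 0 < Num.min d (eta / (1 + gamma)) / 2.
  by rewrite divr_gt0// lt_min d0 divr_gt0.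
apply/near_norm; exists (Num.min d (eta / (1 + gamma)) / 2) => //.
set D := Num.min _ _ / 2 in D0 *.
have [Dd De] : 2 * D <= d /\ 2 * D * (1 + gamma) <= eta.
  rewrite -(ler_pdivlMr _ _ g1) [2 * D]mulrC divfK//.
  by split; rewrite ge_min lexx ?orbT.
move=> p pD; have pz : `|shear gamma p - zb| < D * (1 + gamma).
  apply: (le_lt_trans (shear_lipschitz p (xb, vb))).
  by rewrite mulrC ltr_pM2r.
have near_z a : `|a - shear gamma p| < D * (1 + gamma) -> `|a - zb| < eta.
  by move=> h; have := ler_normD (a - shear gamma p) (shear gamma p - zb);
     rewrite addrA subrK; lra.
exists (Num.min D (D * (1 + gamma))), (1 - gamma * r)^-1; split.
- by rewrite lt_min D0 mulr_gt0.
- by rewrite invr_ge0 ltW.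
- move=> q; rewrite lt_min => /andP[qD _].
  have q_near : `|q - (xb, vb)| < d.
    by have := ler_normD (q - p) (p - (xb, vb)); rewrite addrA subrK; lra.
  have q1 : `|q.1 - xb| < d.
    by apply: le_lt_trans q_near; rewrite [leRHS]prod_normE le_max lexx.
  have q2 : `|q.2 - vb| < d.
    by apply: le_lt_trans q_near; rewrite [leRHS]prod_normE le_max lexx orbT.
  have qz : `|shear gamma q - zb| < eta.
    apply: near_z; apply: (le_lt_trans (shear_lipschitz q p)).
    by rewrite mulrC ltr_pM2r.
  have [E sg _ _] := hP qz; split=> [hq|Pq].
    have : [set P (shear gamma q)] q.1 by rewrite -E prox_graph_point.
    by [].
  by move: sg; rewrite Pq (shear_snd gamma0).
- move=> a b; rewrite !lt_min => /andP[_ /near_z ha] /andP[_ /near_z hb].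
  exact: selection_lipschitz.
Qed.

Lemma near_zb_selection : \forall z \near zb, `|z - zb| < eta.
Proof. by apply/near_norm; exists eta. Qed.

(** Points near [zb] and points of the graph near [(xb, vb)] correspond to each
other continuously through [unshear] and [shear], so the pointwise equivalence
transfers between the two neighborhoods. *)
Lemma strict_proto_iff_selection :
  strictly_proto_differentiable_around ip f xb vb <->
  \forall z \near zb, strictly_differentiable P z.
Proof.
have res := selection_local_resolvent; split=> h.
- have g0 : 0 < 1 - gamma * r by rewrite subr_gt0.
  have [e e0 he] : exists2 e : R, 0 < e & forall p, `|p - (xb, vb)| < e ->
      local_resolvent gamma (graph (subdifferential ip f)) P p /\
      (graph (subdifferential ip f) p ->
       strictly_proto_differentiable (subdifferential ip f) p.1 p.2).
    by apply/near_norm; exact: filterI.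
  (* [k] is a Lipschitz constant of [unshear P] at [zb] *)
  pose k := (1 - gamma * r)^-1 + gamma^-1 * (1 + (1 - gamma * r)^-1).
  have k0 : 0 < k.
    by rewrite addr_gt0 ?invr_gt0// mulr_gt0 ?invr_gt0// addr_gt0 ?invr_gt0.
  apply/near_norm; exists (Num.min eta (e / k)).
    by rewrite lt_min eta0 divr_gt0.
  move=> z; rewrite lt_min ltr_pdivlMr// => /andP[ze zk].
  have zz : `|zb - zb| < eta by rewrite subrr normr0.
  have L := selection_lipschitz ze zz; rewrite selection_zb in L.
  have pe : `|unshear gamma P z - (xb, vb)| < e.
    apply: le_lt_trans zk; rewrite [leLHS]prod_normE ge_max /=.
    apply/andP; split.
      rewrite (le_trans L)// mulrC ler_wpM2l// lerDl.
      by rewrite mulr_ge0 ?invr_ge0 ?addr_ge0 ?invr_ge0// ltW.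
    rewrite residual_offset normrZ gtr0_norm ?invr_gt0//.
    apply: (@le_trans _ _ (gamma^-1 * (1 + (1 - gamma * r)^-1) * `|z - zb|)).
      rewrite -mulrA ler_wpM2l ?invr_ge0 ?(ltW gamma0)//.
      by rewrite (le_trans (ler_normB _ _))// mulrDl mul1r lerD2l.
    by rewrite mulrC ler_wpM2l// lerDr invr_ge0 ltW.
  have [resp proto] := he _ pe.
  have Gp : graph (subdifferential ip f) (unshear gamma P z).
    by have [_ ? _ _] := hP ze.
  rewrite -(shear_unshear gamma0 P z).
  exact: (strict_proto_strictly_differentiable hip hdim gamma0 Gp resp
            (proto Gp)).
- have [e e0 he] := (near_norm _ _).1 h.
  have g1 : 0 < 1 + gamma by rewrite addr_gt0.
  have small : \forall p \near (xb, vb), `|p - (xb, vb)| < e / (1 + gamma).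
    by apply/near_norm; exists (e / (1 + gamma)) => //; rewrite divr_gt0.
  near=> p => Gp.
  apply: (strictly_differentiable_strict_proto gamma0 (P := P)).
  + by case: (p) Gp.
  + by rewrite -surjective_pairing; near: p.
  + rewrite -surjective_pairing; apply: he.
    apply: (le_lt_trans (shear_lipschitz p (xb, vb))).
    by rewrite mulrC -ltr_pdivlMr//; near: p.
Unshelve. all: by end_near. Qed.

Lemma prox_C1_iff_selection :
  set_valued_C1_around (prox gamma f) zb <->
  \forall z \near zb, strictly_differentiable P z.
Proof.
have Pset : \forall z \near zb, prox gamma f z = [set P z].
  by move: near_zb_selection; apply: filterS => z /hP[].
split=> [[p [hp /(C1_aroundP hip)]]|h].
  apply: near_strictly_differentiable_eq; move: hp Pset.
  apply: filterS2 => z -> /seteqP[h _]; exact: h.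
by exists P; split=> //; exact/(C1_aroundP hip).
Qed.

Definition envelope_gradient z := gamma^-1 *: (z - P z).

Lemma envelope_selection z : `|z - zb| < eta ->
  envelope gamma f z = (fine (phi z (P z)))%:E.
Proof.
move=> /hP[Ez [fz _] _ _].
have Pz : prox gamma f z (P z) by rewrite Ez.
have fp : phi z (P z) \is a fin_num by rewrite fin_numD fz.
rewrite fineK//; apply/eqP; rewrite eq_le; apply/andP; split.
  by apply: ereal_inf_lbound; exists (P z).
by apply: le_ereal_inf_tmp => _ [w _ <-]; exact: Pz.
Qed.

(** [P a] competes in the minimization at [b]. *)
Lemma envelope_upper a b : `|a - zb| < eta -> `|b - zb| < eta ->
  fine (envelope gamma f b) <= fine (envelope gamma f a) +
    ip (envelope_gradient a) (b - a) + (2 * gamma)^-1 * `|b - a| ^+ 2.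
Proof.
move=> ha hb; have [_ [fa _] _ _] := hP ha; have [Eb [fb _] _ _] := hP hb.
have Pb : prox gamma f b (P b) by rewrite Eb.
rewrite !envelope_selection//=; have := Pb (P a).
rewrite /prox_objective -(fineK fa) -(fineK fb) -!EFinD lee_fin /=.
move=> /le_trans; apply; rewrite -addrA -addrA lerD2l.
have -> : P a - b = (P a - a) - (b - a) by rewrite opprB addrA subrK.
rewrite (normB_sqr hip) /envelope_gradient ipZl -(opprB (P a) a) ipNl.
rewrite le_eqVlt; apply/orP; left; apply/eqP; field; exact: lt0r_neq0.
Qed.

(** Exchanging the two points in [envelope_upper] gives the reverse inequality
with the gradient at the other point, and the gradient is Lipschitz. *)
Lemma envelope_diff z : `|z - zb| < eta ->
  differentiable (fine \o envelope gamma f) z /\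
  forall h, 'd (fine \o envelope gamma f) z h = ip (envelope_gradient z) h.
Proof.
move=> hz; pose L := (1 - gamma * r)^-1.
have g1 : 0 < 1 - gamma * r by rewrite subr_gt0.
have L0 : 0 < L by rewrite invr_gt0.
have grad_lip a : `|a - zb| < eta ->
    `|envelope_gradient a - envelope_gradient z| <=
      gamma^-1 * (1 + L) * `|a - z|.
  move=> ha; rewrite /envelope_gradient -scalerBr normrZ gtr0_norm ?invr_gt0//.
  rewrite -mulrA ler_wpM2l ?invr_ge0 ?(ltW gamma0)//.
  have -> : a - P a - (z - P z) = (a - z) - (P a - P z).
    by rewrite !opprB addrACA [RHS]addrACA [- P a - z]addrC.
  rewrite (le_trans (ler_normB _ _))// mulrDl mul1r lerD2l.
  exact: selection_lipschitz.
pose C := gamma^-1 * (1 + L) + (2 * gamma)^-1.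
have ig0 : 0 < (2 * gamma)^-1 by rewrite invr_gt0 mulr_gt0.
have C0 : 0 < C by rewrite addr_gt0// mulr_gt0 ?invr_gt0// addr_gt0.
have est a : `|a - zb| < eta -> `|fine (envelope gamma f a) -
    fine (envelope gamma f z) - ip (envelope_gradient z) (a - z)| <=
    C * `|a - z| ^+ 2.
  move=> ha; have up := envelope_upper hz ha; have lo := envelope_upper ha hz.
  have q0 : 0 <= gamma^-1 * (1 + L) * `|a - z| ^+ 2.
    by rewrite !mulr_ge0 ?sqr_ge0 ?invr_ge0// ?addr_ge0// ltW.
  have gl : - (gamma^-1 * (1 + L) * `|a - z| ^+ 2) <=
      ip (envelope_gradient a - envelope_gradient z) (a - z).
    have := ip_norm_le hip (envelope_gradient a - envelope_gradient z) (a - z).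
    rewrite ler_norml => /andP[h _]; apply: le_trans h.
    by rewrite lerN2 expr2 mulrA ler_wpM2r// grad_lip.
  rewrite -(opprB a z) (ipC ip _ (- _)) ipNl (ipC ip (a - z)) normrN in lo.
  rewrite ipBl in gl.
  by rewrite ler_norml /C; apply/andP; split; lra.
have [||dz ->] := @is_diff_estimate _ _ _ (fine \o envelope gamma f) z
    (ip (envelope_gradient z)) `|envelope_gradient z| => //.
- by move=> h; exact: (ip_norm_le hip).
- move=> e e0; exists (Num.min (eta - `|z - zb|) (e / C)).
    by rewrite lt_min subr_gt0 hz divr_gt0.
  move=> a; rewrite lt_min ltr_pdivlMr// => /andP[az aC].
  have ha : `|a - zb| < eta.
    by have := ler_normD (a - z) (z - zb); rewrite addrA subrK; lra.
  by rewrite (le_trans (est a ha))// expr2 mulrA ler_wpM2r// mulrC ltW.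
Qed.

Lemma ip_inj (u v : X) : (forall h, ip u h = ip v h) -> u = v.
Proof.
move=> h; apply/eqP; rewrite -subr_eq0 -normr_eq0 -sqrf_eq0 hip ipBl h.
by rewrite -ipBl subrr ip0l.
Qed.

Lemma envelope_C2_iff_selection :
  ereal_C2_around ip (envelope gamma f) zb <->
  \forall z \near zb, strictly_differentiable P z.
Proof.
have gn0 := lt0r_neq0 gamma0.
split=> [[_ [G [hG /(C1_aroundP hip) sG]]]|sP].
  have GE : \forall z \near zb, G z = envelope_gradient z.
    move: hG near_zb_selection; apply: filterS2 => z [_ hz].
    by move=> /envelope_diff[_ hz']; apply: ip_inj => h; rewrite -hz hz'.
  have := near_strictly_differentiable_eq GE sG; apply: filterS => z.
  move=> /(strictly_differentiable_affine 1 (- gamma)).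
  apply: strictly_differentiable_near; apply: nearW => y.
  rewrite /envelope_gradient scale1r scalerA mulNr divff// scaleN1r opprB.
  by rewrite addrC subrK.
split.
  by move: near_zb_selection; apply: filterS => z /envelope_selection ->.
exists envelope_gradient; split.
  by move: near_zb_selection; apply: filterS => z; exact: envelope_diff.
apply/(C1_aroundP hip); move: sP; apply: filterS => z.
move=> /(strictly_differentiable_affine gamma^-1 (- gamma^-1)).
apply: strictly_differentiable_near; apply: nearW => y.
by rewrite scaleNr -scalerBr.
Qed.

End proximal_mapping.

(** * Equivalence for a fixed parameter *)

Section fixed_parameter.
Context {R : realType} {X : normedModType R} (ip : {dot X for idfun}).
Hypotheses (hip : induces_norm ip) (hdim : finite_dimensional X).

(** For a single admissible parameter the three properties are equivalent:
all of them say that the local selection of the proximal mapping is strictly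
differentiable around [xb + gamma *: vb]. *)
Lemma prox_envelope_proto_equiv (f : X -> \bar R) (xb vb : X) (r d : R) :
  0 < d ->
  (forall x v, subdifferential ip f x v -> `|x - xb| < d -> `|v - vb| < d ->
    forall y, (f x + (ip v (y - x) - r / 2 * `|y - x| ^+ 2)%:E <= f y)%E) ->
  subdifferential ip f xb vb -> locally_lsc f xb ->
  forall gamma, 0 < gamma -> gamma * r < 1 ->
    (set_valued_C1_around (prox gamma f) (xb + gamma *: vb) <->
     strictly_proto_differentiable_around ip f xb vb) /\
    (ereal_C2_around ip (envelope gamma f) (xb + gamma *: vb) <->
     strictly_proto_differentiable_around ip f xb vb).
Proof.
move=> d0 hglob hvb hlsc gamma g0 gr.
have [P [eta [eta0 hP]]] :=
  exists_prox_selection hip hdim g0 gr d0 hglob hvb hlsc.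
have sel := strict_proto_iff_selection hip hdim g0 gr d0 hglob hvb eta0 hP.
split; apply: iff_trans (iff_sym sel).
  exact: (prox_C1_iff_selection hip eta0 hP).
exact: (envelope_C2_iff_selection hip g0 gr hglob eta0 hP).
Qed.

End fixed_parameter.

Unset Implicit Arguments.

Theorem theorem4p7 (R : realType) (X : normedModType R)
    (ip : {dot X for idfun}) (f : X -> \bar R) (xb vb : X)
    (hip : induces_norm ip) (hdim : finite_dimensional X)
    (hvb : subdifferential ip f xb vb)
    (hprox : prox_regular ip f xb vb)
    (hcont : subdifferentially_continuous ip f xb vb)
    (hbdd : prox_bounded f) :
  [<-> exists2 r : R, 0 < r & prox_C1_below f xb vb r;
       exists2 r : R, 0 < r & envelope_C2_below ip f xb vb r;
       strictly_proto_differentiable_around ip f xb vb]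
  /\
  (convex_ereal f ->
   [<-> prox_C1_below f xb vb 0;
        envelope_C2_below ip f xb vb 0;
        strictly_proto_differentiable_around ip f xb vb]).
Proof.
have hlsc : locally_lsc f xb by case: hprox.
split=> [|cf].
- have [d [r [d0 r0 hglob]]] := prox_regular_global hip hprox hcont hbdd.
  have key := prox_envelope_proto_equiv hip hdim d0 hglob hvb hlsc.
  (* a parameter below any prescribed [1 / s] that is also admissible *)
  have pick (s : R) : 0 < s -> exists gamma : R,
      [/\ 0 < gamma, (gamma%:E < (s%:E)^-1)%E & gamma * r < 1].
    move=> s0; exists (s + r + 1)^-1.
    have t0 : 0 < s + r + 1 by lra.
    split; first by rewrite invr_gt0.
      by rewrite inver gt_eqF// lte_fin ltf_pV2 ?posrE//; lra.
    by rewrite mulrC ltr_pdivrMr// mul1r; lra.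
  have admissible (gamma : R) : 0 < gamma -> (gamma%:E < ((r + 1)%:E)^-1)%E ->
      gamma * r < 1.
    move=> g0; have r1 : 0 < r + 1 by lra.
    by rewrite inver gt_eqF// lte_fin -div1r ltr_pdivlMr//; lra.
  have r1 : 0 < r + 1 by lra.
  tfae.
  + move=> [s s0 hs]; have [g [g0 gs gr]] := pick s s0.
    exists (r + 1) => // g' g'0 /(admissible _ g'0) g'r.
    by apply/(key _ g'0 g'r).2/(key _ g0 gr).1; exact: hs.
  + move=> [s s0 hs]; have [g [g0 gs gr]] := pick s s0.
    by apply/(key _ g0 gr).2; exact: hs.
  + move=> h; exists (r + 1) => // g' g'0 /(admissible _ g'0) g'r.
    exact/(key _ g'0 g'r).1.
- have hglob x v : subdifferential ip f x v -> `|x - xb| < 1 -> `|v - vb| < 1 ->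
      forall y, (f x + (ip v (y - x) - 0 / 2 * `|y - x| ^+ 2)%:E <= f y)%E.
    by move=> hxv _ _ y; rewrite mul0r mul0r subr0; exact: convex_subgradient.
  have key := prox_envelope_proto_equiv hip hdim ltr01 hglob hvb hlsc.
  have gr (g : R) : g * 0 < 1 by rewrite mulr0.
  have g1 : (1%:E < ((0 : R)%:E)^-1)%E by rewrite inve0 ltry.
  tfae.
  + move=> hs g g0 gy; apply/(key _ g0 (gr _)).2.
    by apply/(key _ (@ltr01 R) (gr _)).1; exact: hs.
  + by move=> hs; apply/(key _ (@ltr01 R) (gr _)).2; exact: hs.
  + by move=> h g g0 _; apply/(key _ g0 (gr _)).1.
Qed.
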